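(* Let $G$ be a group with a conjugation-closed generating set $X$ and let $g\in\mathrm{Mon}(X)$. Let $\mathbf v\in\mathcal F(G,g,\mathbf I)$ with $\rho(\mathbf v)=h$ and let $h'\in[1,g]$ be the element with $hh'=g$. Then the upper set ${\uparrow}(\mathbf v)=\{\mathbf u\in\mathcal F(G,g,\mathbf I):\mathbf v\subseteq\mathbf u\}$ is isomorphic to the topological poset $\mathcal F(G,h',\mathbf I)$. As a consequence, the maximal elements in ${\uparrow}(\mathbf v)$ form a subspace homeomorphic to the order complex $O_{h'}$ of the interval $[1,h']$.
   Context: $\mathrm{Mon}(X)$ is the generated submonoid; $\ell(x)$ is the minimal length of a product of elements of $X$ equal to $x$; $x\le y$ if there is $x'\in\mathrm{Mon}(X)$ with $xx'=y$ and $\ell(x)+\ell(x')=\ell(y)$; $[1,g]=\{x:x\le g\}$. $O_{h'}$ is the order complex of $[1,h']$ with each maximal simplex (maximal chain $x_0<\cdots<x_n$) metrized as the standard orthoscheme $\{0\le y_1\le\cdots\le y_n\le1\}\subset\mathbb R^n$ with $x_i$ at the vertex whose last $i$ coordinates are $1$. A linear factorization of $x$ is $[x_L\ x_1\cdots x_k\ x_R]$ with entries in $\mathrm{Mon}(X)$, $x_1,\dots,x_k\ne1$, lengths summing to $\ell(x)$, product $x$. A weighted linear factorization of $x$ is a function $\mathbf u\colon[0,1]\to G$, trivial at all but finitely many points, such that with $0<s_1<\dots<s_k<1$ the points of $(0,1)$ where $\mathbf u$ is nontrivial, $P(\mathbf u)=[\mathbf u(0)\ \mathbf u(s_1)\cdots\mathbf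 u(s_k)\ \mathbf u(1)]$ is a linear factorization of $x$. The set $\mathrm{WFact}(G,x,\mathbf I)$ of these is a piecewise-Euclidean complex: each cell $\{\mathbf u:P(\mathbf u)=\mathbf x\}$ gets, via $\mathbf u\mapsto\ell\circ\mathbf u$, the metric of an open face of the orthoscheme $\{0\le y_1\le\dots\le y_n\le1\}$, $n=\ell(x)$, in which a multiset of $n$ points of $[0,1]$ listed nondecreasingly is a point. $\mathcal F(G,g,\mathbf I)$ is the topological disjoint union $\bigsqcup_{x\in[1,g]}\mathrm{WFact}(G,x,\mathbf I)$, ordered by $\mathbf v\subseteq\mathbf u$ iff $\mathbf v(r)\le\mathbf u(r)$ for all $r\in[0,1]$. For $\mathbf u\in\mathcal F(G,g,\mathbf I)$, $\rho(\mathbf u)=\prod_{r\in[0,1]}\mathbf u(r)$, the factors ordered left to right by increasing $r$. An isomorphism of topological posets is an order isomorphism that is a homeomorphism. *)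

(* Defs.v *)
From Stdlib Require Import Reals Lra List Sorting.Sorted.
Import ListNotations.
Open Scope R_scope.

Record Grp := {
  gcar :> Type;
  gmul : gcar -> gcar -> gcar;
  gone : gcar;
  ginv : gcar -> gcar;
  gassoc : forall a b c, gmul a (gmul b c) = gmul (gmul a b) c;
  gone_l : forall a, gmul gone a = a;
  ginv_l : forall a, gmul (ginv a) a = gone
}.
Arguments gmul {g}. Arguments gone {g}. Arguments ginv {g}.

Section Defs.
Variable G : Grp.
Variable X : G -> Prop.

Definition gprod (l : list G) : G := fold_right gmul gone l.

Inductive gen_by : G -> Prop :=
| gen_one : gen_by gone
| gen_gen x : X x -> gen_by x
| gen_mul x y : gen_by x -> gen_by y -> gen_by (gmul x y)
| gen_inv x : gen_by x -> gen_by (ginv x).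

Definition generates : Prop := forall x, gen_by x.
Definition conj_closed : Prop := forall x y, X x -> X (gmul (gmul (ginv y) x) y).

Definition Mon (x : G) : Prop := exists l, Forall X l /\ gprod l = x.

Definition len (x : G) (n : nat) : Prop :=
  (exists l, Forall X l /\ gprod l = x /\ length l = n) /\
  (forall l, Forall X l -> gprod l = x -> (n <= length l)%nat).

Definition leG (x y : G) : Prop :=
  exists x', Mon x' /\ gmul x x' = y /\
    exists a b c, len x a /\ len x' b /\ len y c /\ (a + b)%nat = c.

Definition LinFact (x xL : G) (xs : list G) (xR : G) : Prop :=
  Mon xL /\ Forall Mon xs /\ Mon xR /\ Forall (fun y => y <> gone) xs /\
  gprod (xL :: xs ++ [xR]) = x /\
  exists n nL nR ns, len x n /\ len xL nL /\ len xR nR /\ Forall2 len xs ns /\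
    (nL + fold_right Nat.add 0%nat ns + nR)%nat = n.

Definition incr01 (s : list R) : Prop :=
  Sorted Rlt s /\ Forall (fun r => 0 < r < 1) s.

(* weighted linear factorizations: u : [0,1] -> G is encoded as u : R -> G
   which is trivial outside [0,1]. *)
Definition WFact (x : G) (u : R -> G) : Prop :=
  (forall r, (r < 0 \/ 1 < r) -> u r = gone) /\
  exists s, incr01 s /\ (forall r, 0 < r < 1 -> (u r <> gone <-> In r s)) /\
    LinFact x (u 0) (map u s) (u 1).

Definition inF (g : G) (u : R -> G) : Prop :=
  exists x, leG x g /\ WFact x u.

Definition Rho (u : R -> G) (h : G) : Prop :=
  exists s, incr01 s /\ (forall r, 0 < r < 1 -> u r <> gone -> In r s) /\
    h = gprod (u 0 :: map u s ++ [u 1]).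

Definition subF (v u : R -> G) : Prop := forall r, 0 <= r <= 1 -> leG (v r) (u r).

Definition Up (g : G) (v u : R -> G) : Prop := inF g u /\ subF v u.
Definition MaxUp (g : G) (v u : R -> G) : Prop :=
  Up g v u /\ forall w, Up g v w -> subF u w -> w = u.

Definition csimplex (k : nat) (s : list R) : Prop :=
  length s = k /\ Sorted Rle (0 :: s ++ [1]).

Definition relopen (S V : list R -> Prop) : Prop :=
  forall p, S p -> V p -> exists eps, 0 < eps /\
    forall q, S q -> Forall2 (fun a b => Rabs (a - b) < eps) p q -> V q.

(* characteristic map of the closed cell of the linear factorization
   [xL xs xR]: positions 0, s1..sk, 1; coinciding positions multiply
   left to right. *)
Definition chiF (xL : G) (xs : list G) (xR : G) (s : list R) (r : R) : G :=
  if Rlt_dec r 0 then gone else if Rlt_dec 1 r then gone else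
  gprod (map snd (filter (fun p => if Req_EM_T (fst p) r then true else false)
                         (combine (0 :: s ++ [1]) (xL :: xs ++ [xR])))).

(* weak topology of the piecewise-Euclidean complex F(G,g,I)
   (disjoint union over x in [1,g] of WFact(G,x,I)) *)
Definition openF (g : G) (U : (R -> G) -> Prop) : Prop :=
  (forall u, U u -> inF g u) /\
  forall x xL xs xR, leG x g -> LinFact x xL xs xR ->
    relopen (csimplex (length xs)) (fun s => U (chiF xL xs xR s)).

Definition ltG (x y : G) : Prop := leG x y /\ x <> y.

Definition maxchain (h : G) (c : list G) : Prop :=
  Sorted ltG c /\ Forall (fun z => leG z h) c /\
  forall z, leG z h -> (forall y, In y c -> leG z y \/ leG y z) -> In z c.

(* orthoscheme coordinates: for the chain x_0 < ... < x_n and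
   y in {0 <= y1 <= ... <= yn <= 1}, x_i sits at the vertex whose last i
   coordinates are 1; the barycentric weight of x_i is y_{n+1-i} - y_{n-i}
   (with y_0 = 0, y_{n+1} = 1). *)
Definition ochar (c : list G) (y : list R) (t : G -> R) : Prop :=
  (length y + 1)%nat = length c /\
  (forall i, (i < length c)%nat ->
     t (nth i c gone) =
       nth (length y + 1 - i) (0 :: y ++ [1]) 0 - nth (length y - i) (0 :: y ++ [1]) 0) /\
  (forall z, ~ In z c -> t z = 0).

(* points of O_{h'} (as barycentric-coordinate functions G -> R) *)
Definition Opt (h : G) (t : G -> R) : Prop :=
  exists c y, maxchain h c /\ csimplex (length c - 1) y /\ ochar c y t.

(* weak topology of O_{h'} w.r.t. its maximal (orthoscheme) simplices *)
Definition openO (h : G) (U : (G -> R) -> Prop) : Prop :=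
  (forall t, U t -> Opt h t) /\
  forall c, maxchain h c ->
    relopen (csimplex (length c - 1)) (fun y => forall t, ochar c y t -> U t).

End Defs.

Definition relopenT {T : Type} (opens : (T -> Prop) -> Prop) (A V : T -> Prop) : Prop :=
  exists U, opens U /\ forall t, A t -> (V t <-> U t).

Definition contOn {T1 T2 : Type} (op1 : (T1 -> Prop) -> Prop) (A : T1 -> Prop)
  (op2 : (T2 -> Prop) -> Prop) (B : T2 -> Prop) (f : T1 -> T2) : Prop :=
  forall V, relopenT op2 B V -> relopenT op1 A (fun a => V (f a)).

Definition homeo {T1 T2 : Type} (op1 : (T1 -> Prop) -> Prop) (A : T1 -> Prop)
  (op2 : (T2 -> Prop) -> Prop) (B : T2 -> Prop) (f : T1 -> T2) (f' : T2 -> T1) : Prop :=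
  (forall a, A a -> B (f a)) /\ (forall b, B b -> A (f' b)) /\
  (forall a, A a -> f' (f a) = a) /\ (forall b, B b -> f (f' b) = b) /\
  contOn op1 A op2 B f /\ contOn op2 B op1 A f'.

Definition topposet_iso {T1 T2 : Type}
  (op1 : (T1 -> Prop) -> Prop) (A : T1 -> Prop) (le1 : T1 -> T1 -> Prop)
  (op2 : (T2 -> Prop) -> Prop) (B : T2 -> Prop) (le2 : T2 -> T2 -> Prop)
  (f : T1 -> T2) (f' : T2 -> T1) : Prop :=
  homeo op1 A op2 B f f' /\
  forall a b, A a -> A b -> (le1 a b <-> le2 (f a) (f b)).

(* Main.v *)
(* Every point of F(G,g,I) with product x is given by a minimal word e_1 ... e_n in X
   representing x together with a nondecreasing sequence of positions y_1, ..., y_n in [0,1], and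
   the topology is determined by the simplices of positions, one for each word.

   If v is a single generator a at the position r, removing a from u means deleting a factor a on
   the left of u(r) and conjugating all values at positions below r by a^-1, because a has been
   moved to the far left. On each of the finitely many closed pieces of a simplex where a given
   block of positions equals r, this map and its inverse delete or insert one coordinate, so both
   are continuous. The general isomorphism follows by removing the generators of v one at a time.

   An element u of F(G,h',I) with product x, where x k = h', has an upper set isomorphic to
   F(G,k,I), so u is maximal iff k = 1. Finally, the suffix products of a minimal word of h' form a
   maximal chain of [1,h'], every maximal chain arises once in this way, and the function u and the
   barycentric coordinates on the chain determine each other: both reduce to the same normal
   form, in which positions increase strictly and factors are nontrivial. *)

Require Import Defs.
From Stdlib Require Import Reals Lra Lia List Sorting.Sorted.
From Stdlib Require Import Classical ClassicalEpsilon FunctionalExtensionality.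
Import ListNotations.
Local Open Scope R_scope.

(** * Subspaces and homeomorphisms *)

(** A relatively open subset of [B'] is the trace of an ambient open set, whose preimage, computed
    over the larger [A], is then cut down to [A']. *)
Lemma contOn_restrict {T1 T2 : Type} (op1 : (T1 -> Prop) -> Prop)
  (op2 : (T2 -> Prop) -> Prop) (A A' : T1 -> Prop) (B B' : T2 -> Prop) f :
  contOn op1 A op2 B f -> (forall a, A' a -> A a) ->
  (forall a, A' a -> B' (f a)) -> (forall b, B' b -> B b) -> contOn op1 A' op2 B' f.
Proof.
intros Hf HA Hm HB V (U & HU & E).
destruct (Hf U) as (W & HW & E').
{ exists U; split; [exact HU|reflexivity]. }
exists W; split; [exact HW|]; intros a Ha.
rewrite (E (f a)), (E' a) by auto; reflexivity.
Qed.

Section Subspaces.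
Context {T1 T2 T3 : Type} (op1 : (T1 -> Prop) -> Prop) (op2 : (T2 -> Prop) -> Prop)
  (op3 : (T3 -> Prop) -> Prop).

(** Serves to pass to upper sets and to maximal elements. That [f'] maps [B'] into [A'] follows from
    [f (f' b) = b]. *)
Lemma homeo_restrict (A A' : T1 -> Prop) (B B' : T2 -> Prop) f f' :
  homeo op1 A op2 B f f' -> (forall a, A' a -> A a) -> (forall b, B' b -> B b) ->
  (forall a, A a -> A' a <-> B' (f a)) -> homeo op1 A' op2 B' f f'.
Proof.
intros (H1 & H2 & H3 & H4 & H5 & H6) HA HB HAB.
assert (K : forall b, B' b -> A' (f' b)).
{ intros b Hb; apply HAB; [auto|rewrite H4; auto]. }
repeat split; auto.
- intros a Ha; apply HAB; auto.
- apply (contOn_restrict _ _ A A' B B'); auto; intros a Ha; apply HAB; auto.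
- apply (contOn_restrict _ _ B B' A A'); auto.
Qed.

Lemma homeo_comp (A : T1 -> Prop) (B : T2 -> Prop) (C : T3 -> Prop) f f' k k' :
  homeo op1 A op2 B f f' -> homeo op2 B op3 C k k' ->
  homeo op1 A op3 C (fun a => k (f a)) (fun c => f' (k' c)).
Proof.
intros (H1 & H2 & H3 & H4 & H5 & H6) (K1 & K2 & K3 & K4 & K5 & K6).
repeat split; auto.
- intros a Ha; rewrite K3; auto.
- intros c Hc; rewrite H4; auto.
- intros V HV; apply (H5 (fun b => V (k b))), K5, HV.
- intros V HV; apply (K6 (fun b => V (f' b))), H6, HV.
Qed.

End Subspaces.

Local Infix "**" := gmul (at level 40, left associativity).

(** * Groups *)

Section GroupLaws.
Context {G : Grp}.
Implicit Types a b c x y : G.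

Lemma ginv_r a : a ** ginv a = gone.
Proof.
rewrite <- (gone_l _ (a ** ginv a)), <- (ginv_l _ (ginv a)) at 1.
rewrite <- gassoc, (gassoc _ (ginv a) a), ginv_l, gone_l, ginv_l; reflexivity.
Qed.

Lemma gone_r a : a ** gone = a.
Proof. rewrite <- (ginv_l _ a), gassoc, ginv_r, gone_l; reflexivity. Qed.

Lemma gmulK a b : a ** b ** ginv b = a.
Proof. rewrite <- gassoc, ginv_r, gone_r; reflexivity. Qed.

Lemma gmulVK a b : a ** ginv b ** b = a.
Proof. rewrite <- gassoc, ginv_l, gone_r; reflexivity. Qed.

Lemma gcancel_l a b c : a ** b = a ** c -> b = c.
Proof.
intros H; rewrite <- (gone_l _ b), <- (gone_l _ c), <- (ginv_l _ a), <- !gassoc, H.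
reflexivity.
Qed.

Lemma gcancel_r a b c : b ** a = c ** a -> b = c.
Proof. intros H; rewrite <- (gmulK b a), <- (gmulK c a), H; reflexivity. Qed.

Lemma ginv_mul a b : ginv (a ** b) = ginv b ** ginv a.
Proof.
apply (gcancel_r (a ** b)); rewrite ginv_l, !gassoc, gmulVK, ginv_l; reflexivity.
Qed.

Lemma ginv_inv a : ginv (ginv a) = a.
Proof. apply (gcancel_r (ginv a)); rewrite ginv_l, ginv_r; reflexivity. Qed.

Lemma ginv_one : ginv (gone : G) = gone.
Proof. rewrite <- (gone_r (ginv gone)), ginv_l; reflexivity. Qed.

Lemma gprod_app (l1 l2 : list G) : gprod G (l1 ++ l2) = gprod G l1 ** gprod G l2.
Proof.
induction l1 as [|a l1 IH]; simpl; [rewrite gone_l|rewrite IH, gassoc]; reflexivity.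
Qed.

(** What [x] becomes when it is carried from the right of [a] to its left, see [lconj_swap]. *)
Definition lconj a x : G := a ** x ** ginv a.

Lemma lconj_mul a x y : lconj a (x ** y) = lconj a x ** lconj a y.
Proof. unfold lconj; rewrite !gassoc, gmulVK; reflexivity. Qed.

Lemma lconj_one a : lconj a gone = gone.
Proof. unfold lconj; rewrite gone_r; apply ginv_r. Qed.

Lemma lconjK a x : lconj (ginv a) (lconj a x) = x.
Proof.
unfold lconj; rewrite ginv_inv, !gassoc, ginv_l, gone_l, gmulVK; reflexivity.
Qed.

Lemma lconjVK a x : lconj a (lconj (ginv a) x) = x.
Proof. rewrite <- (ginv_inv a) at 1; apply lconjK. Qed.

Lemma lconj_swap a x : lconj a x ** a = a ** x.
Proof. apply gmulVK. Qed.

Lemma gprod_lconj a (l : list G) : gprod G (map (lconj a) l) = lconj a (gprod G l).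
Proof.
induction l as [|x l IH]; simpl; [symmetry; apply lconj_one|].
rewrite IH, lconj_mul; reflexivity.
Qed.

End GroupLaws.

Hint Rewrite @gassoc @ginv_r @ginv_l @gone_l @gone_r @gmulK @gmulVK @ginv_mul
  @ginv_inv @ginv_one : grp.
Ltac grp := autorewrite with grp; try reflexivity.

(** * Length and the prefix order *)

Section Poset.
Context (G : Grp) (X : G -> Prop) (HX : conj_closed G X).

Local Notation gprod := (gprod G).
Local Notation Mon := (Mon G X).
Local Notation len := (len G X).
Local Notation leG := (leG G X).

Lemma X_lconj a x : X x -> X (lconj a x).
Proof. intros H; assert (H' := HX x (ginv a) H); rewrite ginv_inv in H'; exact H'. Qed.

Lemma Mon_one : Mon gone.
Proof. exists nil; split; [constructor|reflexivity]. Qed.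

Lemma Mon_X x : X x -> Mon x.
Proof. intros H; exists [x]; split; [auto|apply gone_r]. Qed.

Lemma Mon_mul x y : Mon x -> Mon y -> Mon (x ** y).
Proof.
intros (l & H & <-) (l' & H' & <-); exists (l ++ l').
split; [apply Forall_app; auto|apply gprod_app].
Qed.

Lemma Mon_lconj a x : Mon x -> Mon (lconj a x).
Proof.
intros (l & H & <-); exists (map (lconj a) l); split; [|apply gprod_lconj].
apply Forall_map; revert H; apply Forall_impl; intros; apply X_lconj; auto.
Qed.

Lemma Mon_gprod (l : list G) : Forall Mon l -> Mon (gprod l).
Proof.
induction 1; simpl; [apply Mon_one|apply Mon_mul; auto].
Qed.

Lemma len_Mon x n : len x n -> Mon x.
Proof. intros [(l & H & H' & _) _]; exists l; auto. Qed.

Lemma len_inj x n m : len x n -> len x m -> n = m.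
Proof.
intros [(l & H1 & H2 & <-) H3] [(l' & H1' & H2' & <-) H3'].
specialize (H3 _ H1' H2'); specialize (H3' _ H1 H2); lia.
Qed.

Lemma len_exists x : Mon x -> exists n, len x n.
Proof.
intros (l & H & H').
destruct (Wf_nat.dec_inh_nat_subset_has_unique_least_element
  (fun n => exists l, Forall X l /\ gprod l = x /\ length l = n)) as (n & [Hn Hmin] & _).
- intros n; apply classic.
- exists (length l), l; auto.
- exists n; split; [exact Hn|]; intros l' H1 H2; apply Hmin; exists l'; auto.
Qed.

(** Turns the relation [len] into a function, so that length equations are plain arithmetic. Outside
    [Mon] the value is arbitrary. *)
Definition ell x : nat := epsilon (inhabits 0%nat) (len x).

Lemma ell_len x : Mon x -> len x (ell x).
Proof. intros H; unfold ell; apply epsilon_spec, len_exists, H. Qed.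

Lemma len_ell x n : len x n -> ell x = n.
Proof. intros H; eapply len_inj; [apply ell_len|]; eauto using len_Mon. Qed.

Lemma ell_le (l : list G) : Forall X l -> (ell (gprod l) <= length l)%nat.
Proof. intros H; apply (ell_len (gprod l)); [exists l|..]; auto. Qed.

Lemma ell_word x : Mon x -> exists l, Forall X l /\ gprod l = x /\ length l = ell x.
Proof. intros H; apply (ell_len x H). Qed.

Lemma ell_mul x y : Mon x -> Mon y -> (ell (x ** y) <= ell x + ell y)%nat.
Proof.
intros (l & H1 & <- & <-)%ell_word (l' & H1' & <- & <-)%ell_word.
rewrite <- gprod_app, <- length_app; apply ell_le, Forall_app; auto.
Qed.

Lemma ell_one : ell gone = 0%nat.
Proof. apply len_ell; split; [exists nil; auto|intros; lia]. Qed.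

Lemma ell_eq0 x : Mon x -> ell x = 0%nat -> x = gone.
Proof.
intros (l & _ & <- & Hl)%ell_word H; rewrite H in Hl.
destruct l; [reflexivity|discriminate].
Qed.

Lemma ell_lconj_le a x : Mon x -> (ell (lconj a x) <= ell x)%nat.
Proof.
intros (l & H & <- & <-)%ell_word; rewrite <- gprod_lconj, <- (length_map (lconj a)).
apply ell_le, Forall_map; revert H; apply Forall_impl; intros; apply X_lconj; auto.
Qed.

Lemma ell_lconj a x : Mon x -> ell (lconj a x) = ell x.
Proof.
intros H; apply Nat.le_antisymm; [apply ell_lconj_le, H|].
rewrite <- (lconjK a x) at 1; apply ell_lconj_le, Mon_lconj, H.
Qed.

Lemma leG_iff x y : leG x y <->
  exists z, Mon x /\ Mon z /\ x ** z = y /\ (ell x + ell z)%nat = ell y.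
Proof.
split.
- intros (z & Hz & <- & n & m & k & H1 & H2 & H3 & H4); exists z.
  rewrite (len_ell _ _ H1), (len_ell _ _ H2), (len_ell _ _ H3); eauto using len_Mon.
- intros (z & Hx & Hz & <- & H); exists z; split; [auto|split; [auto|]].
  exists (ell x), (ell z), (ell (x ** z)); repeat split; auto;
    apply ell_len; auto using Mon_mul.
Qed.

Lemma leG_mul x z : Mon x -> Mon z -> ell (x ** z) = (ell x + ell z)%nat ->
  leG x (x ** z).
Proof. intros; apply leG_iff; exists z; auto. Qed.

(* [x ** z = z ** (ginv z ** x ** z)], and conjugation preserves the length. *)
Lemma leG_mul_r x z : Mon x -> Mon z -> ell (x ** z) = (ell x + ell z)%nat ->
  leG z (x ** z).
Proof.
intros Hx Hz H; apply leG_iff; exists (lconj (ginv z) x); repeat split; auto.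
- apply Mon_lconj, Hx.
- unfold lconj; grp.
- rewrite ell_lconj by auto; lia.
Qed.

Lemma leG_Mon_l x y : leG x y -> Mon x.
Proof. intros (z & H & _)%leG_iff; exact H. Qed.

Lemma leG_ell x y : leG x y -> (ell x <= ell y)%nat.
Proof. intros (z & _ & _ & _ & H)%leG_iff; lia. Qed.

Lemma leG_one x : Mon x -> leG gone x.
Proof.
intros H; apply leG_iff; exists x; rewrite ell_one, gone_l; auto using Mon_one.
Qed.

Lemma leG_refl x : Mon x -> leG x x.
Proof.
intros H; apply leG_iff; exists gone; rewrite ell_one, gone_r; auto using Mon_one.
Qed.

Lemma leG_trans x y z : leG x y -> leG y z -> leG x z.
Proof.
intros (u & Hx & Hu & <- & E1)%leG_iff (w & Hy & Hw & <- & E2)%leG_iff.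
apply leG_iff; exists (u ** w); repeat split; auto using Mon_mul; [grp|].
(* Subadditivity for the two bracketings of [x ** u ** w] squeezes the length of [u ** w] from both
   sides. *)
assert (ell (x ** u ** w) <= ell x + ell (u ** w))%nat
  by (rewrite <- gassoc; apply ell_mul; auto using Mon_mul).
assert (ell (u ** w) <= ell u + ell w)%nat by (apply ell_mul; auto).
lia.
Qed.

Lemma leG_ell_eq x y : leG x y -> ell x = ell y -> x = y.
Proof.
intros (z & _ & Hz & <- & E)%leG_iff E'.
rewrite (ell_eq0 z Hz) by lia; symmetry; apply gone_r.
Qed.

Lemma leG_antisym x y : leG x y -> leG y x -> x = y.
Proof.
intros H1 H2; apply leG_ell_eq; [exact H1|].
apply leG_ell in H1, H2; lia.
Qed.

Lemma ltG_ell x y : ltG G X x y -> (ell x < ell y)%nat.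
Proof.
intros [H Hn]; assert (Hl := leG_ell _ _ H).
destruct (Nat.eq_dec (ell x) (ell y)); [destruct Hn; apply leG_ell_eq; auto|lia].
Qed.

Lemma leG_lconj a x y : leG x y -> leG (lconj a x) (lconj a y).
Proof.
intros (z & Hx & Hz & <- & E)%leG_iff; rewrite lconj_mul.
apply leG_mul; try (apply Mon_lconj; auto).
rewrite <- lconj_mul, !ell_lconj; auto using Mon_mul.
Qed.

Lemma leG_lconj_iff a x y : leG (lconj a x) (lconj a y) <-> leG x y.
Proof.
split; [|apply leG_lconj].
intros H%(leG_lconj (ginv a)); rewrite !lconjK in H; exact H.
Qed.

(** The same complement [z] works on both sides, and both length equations differ by [ell a]. *)
Lemma leG_mul_l_iff a x y : Mon a -> Mon x -> Mon y ->
  ell (a ** x) = (ell a + ell x)%nat -> ell (a ** y) = (ell a + ell y)%nat ->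
  leG (a ** x) (a ** y) <-> leG x y.
Proof.
intros Ha Hx Hy E1 E2; rewrite !leG_iff; split; intros (z & _ & Hz & E & E3);
  exists z; repeat split; auto using Mon_mul.
- apply (gcancel_l a); rewrite gassoc; exact E.
- lia.
- rewrite <- gassoc, E; reflexivity.
- lia.
Qed.

(** * Minimal words in the generators *)

Definition word (l : list G) : Prop := Forall X l /\ ell (gprod l) = length l.

Lemma word_Mon l : word l -> Mon (gprod l).
Proof. intros [H _]; exists l; auto. Qed.

Lemma word_of x : Mon x -> exists l, word l /\ gprod l = x.
Proof.
intros (l & H & <- & E)%ell_word; exists l; repeat split; auto.
Qed.

Lemma word_nil : word nil.
Proof. split; [constructor|apply ell_one]. Qed.

(** A shorter word for either part would shorten the whole. *)
Lemma word_app l1 l2 : word (l1 ++ l2) -> word l1 /\ word l2.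
Proof.
intros [H E]; apply Forall_app in H; destruct H as [H1 H2].
rewrite gprod_app, length_app in E.
assert (H1' := ell_le _ H1); assert (H2' := ell_le _ H2).
assert (ell (gprod l1 ** gprod l2) <= ell (gprod l1) + ell (gprod l2))%nat
  by (apply ell_mul; [exists l1|exists l2]; auto).
split; split; auto; lia.
Qed.

Lemma word_app_inv l1 l2 : word l1 -> word l2 ->
  ell (gprod l1 ** gprod l2) = (ell (gprod l1) + ell (gprod l2))%nat -> word (l1 ++ l2).
Proof.
intros [H1 E1] [H2 E2] E; split; [apply Forall_app; auto|].
rewrite gprod_app, length_app; lia.
Qed.

Lemma word_cons a l : word (a :: l) -> X a /\ word l.
Proof.
intros H; change (a :: l) with ([a] ++ l) in H.
apply word_app in H; destruct H as [[H _] H']; inversion H; auto.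
Qed.

Lemma ell_X_le a : X a -> (ell a <= 1)%nat.
Proof.
intros H; rewrite <- (gone_r a); apply (ell_le [a]); auto.
Qed.

Local Notation WFact := (WFact G X).
Local Notation inF := (inF G X).
Local Notation openF := (openF G X).

(** * Weighted factorizations as words with positions *)

(** The length condition of a linear factorization, with trivial entries allowed. *)
Definition additive (es : list G) : Prop :=
  Forall Mon es /\ ell (gprod es) = list_sum (map ell es).

Lemma list_sum_cons n l : list_sum (n :: l) = (n + list_sum l)%nat.
Proof. reflexivity. Qed.

Lemma ell_gprod_le es : Forall Mon es -> (ell (gprod es) <= list_sum (map ell es))%nat.
Proof.
induction 1 as [|e es He Hes IH]; [simpl; rewrite ell_one; lia|].
rewrite map_cons, list_sum_cons; change (gprod (e :: es)) with (e ** gprod es).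
assert (ell (e ** gprod es) <= ell e + ell (gprod es))%nat
  by (apply ell_mul; auto using Mon_gprod).
lia.
Qed.

Lemma additive_cons e es : additive (e :: es) <->
  Mon e /\ additive es /\ ell (e ** gprod es) = (ell e + ell (gprod es))%nat.
Proof.
split.
- intros [H E]; inversion H as [|? ? He Hes]; subst.
  change (ell (e ** gprod es) = list_sum (ell e :: map ell es)) in E.
  assert (H1 := ell_gprod_le es Hes).
  assert (ell (e ** gprod es) <= ell e + ell (gprod es))%nat
    by (apply ell_mul; auto using Mon_gprod).
  unfold additive; rewrite list_sum_cons in *; repeat split; auto; lia.
- intros (He & [Hes E] & E'); split; [auto|simpl]; rewrite E', E; reflexivity.
Qed.

Lemma word_additive es : word es -> additive es /\ Forall (fun e => e <> gone) es.
Proof.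
induction es as [|e es IH]; intros H.
- repeat split; try constructor; apply ell_one.
- destruct (word_cons _ _ H) as [He Hes]; destruct (IH Hes) as [H1 H2].
  assert (E : ell (e ** gprod es) = S (length es)) by apply H.
  assert (E' : ell (gprod es) = length es) by apply Hes.
  assert (H3 := ell_X_le e He).
  assert (ell (e ** gprod es) <= ell e + ell (gprod es))%nat
    by (apply ell_mul; auto using Mon_X, word_Mon).
  split.
  + apply additive_cons; repeat split; try apply H1; auto using Mon_X; lia.
  + constructor; auto; intros ->; rewrite ell_one in *; lia.
Qed.

(** A minimal word is chosen for each entry; since the lengths add up, the concatenation is again
    minimal. *)
Lemma additive_words es : additive es ->
  exists ws, map gprod ws = es /\ word (concat ws).
Proof.
induction es as [|e es IH]; intros H.
- exists nil; split; [reflexivity|apply word_nil].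
- apply additive_cons in H; destruct H as (He & Hes & E).
  destruct (IH Hes) as (ws & E1 & Hws); destruct (word_of e He) as (w & Hw & <-).
  assert (E2 : gprod (concat ws) = gprod es).
  { rewrite <- E1; clear; induction ws as [|w ws IH]; simpl; [reflexivity|].
    rewrite gprod_app, IH; reflexivity. }
  exists (w :: ws); split; simpl; [rewrite E1; reflexivity|].
  apply word_app_inv; auto; rewrite E2; exact E.
Qed.

Lemma gprod_concat (ws : list (list G)) : gprod (concat ws) = gprod (map gprod ws).
Proof.
induction ws as [|w ws IH]; simpl; [reflexivity|rewrite gprod_app, IH; reflexivity].
Qed.

Lemma LinFact_iff x xL xs xR : LinFact G X x xL xs xR <->
  additive (xL :: xs ++ [xR]) /\ Forall (fun y => y <> gone) xs /\
  gprod (xL :: xs ++ [xR]) = x.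
Proof.
assert (Sum : list_sum (map ell (xL :: xs ++ [xR])) =
  (ell xL + list_sum (map ell xs) + ell xR)%nat).
{ rewrite map_cons, map_app; rewrite list_sum_cons, list_sum_app; simpl; lia. }
assert (Len : forall ns, Forall2 len xs ns -> ns = map ell xs).
{ clear Sum; induction 1 as [|y n ys ns H _ IH]; simpl; [reflexivity|].
  rewrite IH, (len_ell _ _ H); reflexivity. }
unfold additive; rewrite Sum; split.
- intros (H1 & H2 & H3 & H4 & <- & n & nL & nR & ns & E1 & E2 & E3 & E4%Len & <-).
  repeat split; auto.
  + constructor; auto; apply Forall_app; auto.
  + rewrite (len_ell _ _ E1), (len_ell _ _ E2), (len_ell _ _ E3), E4; reflexivity.
- intros ((H1 & E) & H2 & <-); inversion H1 as [|? ? HL Hs]; subst.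
  apply Forall_app in Hs; destruct Hs as [Hs HR]; inversion HR as [|? ? HR' _]; subst.
  repeat split; auto.
  exists (ell (gprod (xL :: xs ++ [xR]))), (ell xL), (ell xR), (map ell xs).
  split; [apply ell_len, Mon_gprod, H1|].
  do 2 (split; [apply ell_len; auto|]); split; [|rewrite E; reflexivity].
  clear - Hs; induction Hs; simpl; constructor; auto using ell_len.
Qed.

(** Characteristic map of the simplex of positions of the word [es]: letters at the same position
    are multiplied in order. In contrast to [chiF], the ends 0 and 1 are not adjoined. *)
Fixpoint gat (ys : list R) (es : list G) (r : R) : G :=
  match ys, es with
  | y :: ys', e :: es' => if Req_EM_T y r then e ** gat ys' es' r else gat ys' es' r
  | _, _ => gone
  end.

Lemma gat_app y1 y2 e1 e2 r : length y1 = length e1 ->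
  gat (y1 ++ y2) (e1 ++ e2) r = gat y1 e1 r ** gat y2 e2 r.
Proof.
revert e1; induction y1 as [|y y1 IH]; intros [|e e1] E; try discriminate; simpl.
- rewrite gone_l; reflexivity.
- injection E as E; destruct (Req_EM_T y r); rewrite IH; auto; apply gassoc.
Qed.

Lemma gat_out ys es r : (forall y, In y ys -> y <> r) -> gat ys es r = gone.
Proof.
revert es; induction ys as [|y ys IH]; intros [|e es] H; simpl; auto.
destruct (Req_EM_T y r) as [E|_]; [destruct (H y); simpl; auto|].
apply IH; intros; apply H; simpl; auto.
Qed.

Lemma gat_const ys es r : (forall y, In y ys -> y = r) -> length ys = length es ->
  gat ys es r = gprod es.
Proof.
revert es; induction ys as [|y ys IH]; intros [|e es] H E; try discriminate; simpl; auto.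
destruct (Req_EM_T y r) as [_|n]; [|destruct n; apply H; simpl; auto].
rewrite IH; auto; intros; apply H; simpl; auto.
Qed.

Lemma gat_lconj a ys es r : gat ys (map (lconj a) es) r = lconj a (gat ys es r).
Proof.
revert es; induction ys as [|y ys IH]; intros [|e es]; simpl;
  try (symmetry; apply lconj_one).
destruct (Req_EM_T y r); rewrite IH; auto; symmetry; apply lconj_mul.
Qed.

Lemma gat_map (u : R -> G) S : StronglySorted Rlt S ->
  (forall r, u r <> gone -> In r S) -> gat S (map u S) = u.
Proof.
intros HS Hu; apply functional_extensionality; intros r.
(* Since [S] increases strictly, at most one factor sits at [r]. *)
assert (K : gat S (map u S) r = if In_dec Req_EM_T r S then u r else gone).
{ clear Hu; induction HS as [|y S HS IH Hy]; simpl; [reflexivity|].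
  rewrite IH; destruct (Req_EM_T y r) as [<-|n].
  - destruct (in_dec Req_EM_T y S) as [i|_]; [|apply gone_r].
    rewrite Forall_forall in Hy; specialize (Hy _ i); lra.
  - destruct (in_dec Req_EM_T r S); auto. }
rewrite K; destruct (in_dec Req_EM_T r S) as [|n]; auto.
destruct (classic (u r = gone)); [auto|destruct n; auto].
Qed.

Lemma map_gat ys es : StronglySorted Rlt ys -> length ys = length es ->
  map (gat ys es) ys = es.
Proof.
intros HS; revert es; induction HS as [|y S HS IH Hy]; intros [|e es] E;
  try discriminate; simpl; auto; injection E as E.
rewrite Forall_forall in Hy; f_equal.
- destruct (Req_EM_T y y) as [_|]; [|lra].
  rewrite gat_out; [apply gone_r|]; intros z Hz; specialize (Hy _ Hz); lra.
- transitivity (map (gat S es) S); [|apply IH, E]; apply map_ext_in; intros z Hz.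
  specialize (Hy _ Hz); destruct (Req_EM_T y z); [lra|reflexivity].
Qed.

Definition sorted01 (ys : list R) : Prop :=
  StronglySorted Rle ys /\ (forall y, In y ys -> 0 <= y <= 1).

Lemma SSorted_app {T} (P : T -> T -> Prop) l1 l2 : StronglySorted P (l1 ++ l2) <->
  StronglySorted P l1 /\ StronglySorted P l2 /\
  (forall x y, In x l1 -> In y l2 -> P x y).
Proof.
induction l1 as [|a l1 IH]; simpl.
- split; [intros H; repeat split; auto using SSorted_nil; contradiction|tauto].
- split.
  + intros H; inversion H as [|? ? H1 H2]; subst.
    apply IH in H1; destruct H1 as (H3 & H4 & H5); apply Forall_app in H2.
    destruct H2 as [H2 H2']; rewrite Forall_forall in H2'.
    repeat split; auto; [constructor; auto|intros x y [<-|Hx] Hy; auto].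
  + intros (H1 & H2 & H3); inversion H1; subst; constructor.
    * apply IH; auto.
    * apply Forall_app; split; [auto|apply Forall_forall; auto].
Qed.

Lemma csimplex_iff k ys : csimplex k ys <-> length ys = k /\ sorted01 ys.
Proof.
unfold csimplex, sorted01; apply and_iff_compat_l; split.
- intros H%Sorted_StronglySorted; [|intros x y z; lra].
  inversion H as [|? ? H1 H2]; subst; apply SSorted_app in H1.
  destruct H1 as (H3 & _ & H4); rewrite Forall_forall in H2.
  split; [auto|intros y Hy; split; [apply H2, in_or_app|apply H4]; simpl; auto].
- intros [H1 H2]; apply StronglySorted_Sorted; constructor.
  + apply SSorted_app; repeat split; auto using SSorted_nil, SSorted_cons.
    intros x y Hx [<-|[]]; apply H2, Hx.
  + apply Forall_app; split; [apply Forall_forall; intros; apply H2; auto|].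
    constructor; [lra|auto].
Qed.

Lemma gat_outside ys es r : sorted01 ys -> (r < 0 \/ 1 < r) -> gat ys es r = gone.
Proof. intros [_ H] Hr; apply gat_out; intros y Hy; specialize (H _ Hy); lra. Qed.

Lemma sorted01_ends s : sorted01 s -> sorted01 (0 :: s ++ [1]).
Proof.
intros H; assert (H' := proj2 (csimplex_iff (length s) s) (conj eq_refl H)).
destruct H' as [_ H']; apply Sorted_StronglySorted in H'; [|intros x y z; lra].
split; [auto|]; destruct H as [_ H].
intros y [<-|[Hy|[<-|[]]]%in_app_or]; auto; lra.
Qed.

Lemma chiF_gat xL xs xR s : sorted01 s ->
  chiF G xL xs xR s = gat (0 :: s ++ [1]) (xL :: xs ++ [xR]).
Proof.
intros H; apply functional_extensionality; intros r; unfold chiF.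
destruct (Rlt_dec r 0); [symmetry; apply gat_outside; auto using sorted01_ends|].
destruct (Rlt_dec 1 r); [symmetry; apply gat_outside; auto using sorted01_ends|].
generalize (0 :: s ++ [1]) (xL :: xs ++ [xR]); clear.
induction l as [|y l IH]; intros [|e es]; simpl; auto.
destruct (Req_EM_T y r); simpl; rewrite IH; reflexivity.
Qed.

(** Each position is repeated once for every letter of its word. This embeds the cell of a
    factorization into the simplex of a minimal word; an empty word, standing for a trivial factor,
    loses its position. *)
Fixpoint rep (ws : list (list G)) (ys : list R) : list R :=
  match ws, ys with
  | w :: ws', y :: ys' => repeat y (length w) ++ rep ws' ys'
  | _, _ => nil
  end.

Lemma gat_rep ws ys : gat (rep ws ys) (concat ws) = gat ys (map gprod ws).
Proof.
apply functional_extensionality; intros r.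
revert ys; induction ws as [|w ws IH]; intros [|y ys]; simpl; auto.
rewrite gat_app, IH by apply repeat_length; destruct (Req_EM_T y r) as [<-|n].
- rewrite gat_const; [reflexivity|intros z; apply repeat_spec|apply repeat_length].
- rewrite gat_out; [apply gone_l|].
  intros z Hz; apply repeat_spec in Hz; subst; exact n.
Qed.

Lemma rep_in ws ys z : In z (rep ws ys) -> In z ys.
Proof.
revert ys; induction ws as [|w ws IH]; intros [|y ys]; simpl; try tauto.
intros [H%repeat_spec|H]%in_app_or; auto.
Qed.

Lemma rep_sorted01 ws ys : sorted01 ys -> sorted01 (rep ws ys).
Proof.
intros [H H']; split; [|intros z Hz; apply H', (rep_in ws), Hz].
clear H'; revert ws; induction H as [|y ys H IH Hy]; intros [|w ws]; simpl;
  try constructor.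
rewrite Forall_forall in Hy; apply SSorted_app; repeat split; auto.
- induction (length w) as [|n IHn]; simpl; constructor; auto.
  apply Forall_forall; intros z ->%repeat_spec; lra.
- intros x z ->%repeat_spec Hz%rep_in; auto.
Qed.

Lemma rep_length ws ys : length ys = length ws -> length (rep ws ys) = length (concat ws).
Proof.
revert ys; induction ws as [|w ws IH]; intros [|y ys] E; try discriminate; simpl; auto.
rewrite !length_app, repeat_length, IH; auto.
Qed.

Definition near eps (p q : list R) : Prop := Forall2 (fun a b => Rabs (a - b) < eps) p q.

Lemma near_rep eps ws p q : near eps p q -> near eps (rep ws p) (rep ws q).
Proof.
intros H; revert ws; induction H as [|a b p q Hab H IH]; intros [|w ws]; simpl;
  try constructor.
apply Forall2_app; [|apply IH]; induction (length w); simpl; constructor; auto.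
Qed.

Lemma near_weaken eps eps' p q : eps <= eps' -> near eps p q -> near eps' p q.
Proof. intros E; apply Forall2_impl; intros; lra. Qed.

(** Continuity in the form used throughout: the maps [T] only repeat, insert or delete coordinates,
    so they keep [near] with the same radius. *)
Lemma relopen_comp (S S' V V' : list R -> Prop) (T : list R -> list R) :
  relopen S' V' -> (forall p, S p -> S' (T p)) ->
  (forall p q eps, 0 < eps -> S p -> S q -> near eps p q -> near eps (T p) (T q)) ->
  (forall p, S p -> V p <-> V' (T p)) -> relopen S V.
Proof.
intros HV HS Hn HT p Sp Vp.
destruct (HV (T p) (HS p Sp) (proj1 (HT p Sp) Vp)) as (eps & He & H).
exists eps; split; [exact He|]; intros q Sq Hq; apply HT; auto.
apply H; auto; apply Hn; auto.
Qed.

Lemma filter_SSorted (P : R -> bool) S :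
  StronglySorted Rlt S -> StronglySorted Rlt (filter P S).
Proof.
induction 1 as [|a S H IH Ha]; simpl; [constructor|].
destruct (P a); auto; constructor; auto.
rewrite Forall_forall in *; intros x [Hx _]%filter_In; auto.
Qed.

Lemma SSorted_unique S1 S2 : StronglySorted Rlt S1 -> StronglySorted Rlt S2 ->
  (forall r, In r S1 <-> In r S2) -> S1 = S2.
Proof.
intros H1; revert S2; induction H1 as [|a S1 H1 IH Ha]; intros S2 H2 E.
- destruct S2 as [|b S2]; [auto|]; destruct (proj2 (E b) (or_introl eq_refl)).
- destruct H2 as [|b S2 H2 Hb]; [destruct (proj1 (E a) (or_introl eq_refl))|].
  rewrite Forall_forall in Ha, Hb.
  assert (a = b).
  { destruct (proj1 (E a) (or_introl eq_refl)) as [|Ha']; auto.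
    destruct (proj2 (E b) (or_introl eq_refl)) as [|Hb']; auto.
    specialize (Ha _ Hb'); specialize (Hb _ Ha'); lra. }
  subst b; f_equal; apply IH; auto; intros r; split; intros Hr.
  + destruct (proj1 (E r) (or_intror Hr)) as [->|]; auto; specialize (Ha _ Hr); lra.
  + destruct (proj2 (E r) (or_intror Hr)) as [->|]; auto; specialize (Hb _ Hr); lra.
Qed.

(** Positions with trivial value contribute neither to the product nor to the total length, so only
    the part of each list inside the support counts. *)
Lemma support_values (u : R -> G) S1 S2 :
  StronglySorted Rlt S1 -> StronglySorted Rlt S2 ->
  (forall r, u r <> gone -> In r S1 <-> In r S2) ->
  gprod (map u S1) = gprod (map u S2) /\
  list_sum (map ell (map u S1)) = list_sum (map ell (map u S2)).
Proof.
intros H1 H2 E.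
set (P r := if excluded_middle_informative (u r = gone) then false else true).
assert (HP : forall r, P r = true <-> u r <> gone).
{ intros r; unfold P; destruct (excluded_middle_informative (u r = gone)).
  - split; [discriminate|tauto].
  - tauto. }
assert (F : forall S, gprod (map u (filter P S)) = gprod (map u S) /\
  list_sum (map ell (map u (filter P S))) = list_sum (map ell (map u S))).
{ induction S as [|a S [IH1 IH2]]; simpl; auto.
  destruct (P a) eqn:Ea; simpl; [rewrite IH1, <- IH2; auto|].
  destruct (classic (u a = gone)) as [Eu|Eu%HP]; [|congruence].
  rewrite Eu, ell_one, gone_l; auto. }
rewrite <- (proj1 (F S1)), <- (proj1 (F S2)), <- (proj2 (F S1)), <- (proj2 (F S2)).
rewrite (SSorted_unique (filter P S1) (filter P S2)); auto using filter_SSorted.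
intros r; rewrite !filter_In, HP; specialize (E r); tauto.
Qed.

Lemma incr01_ends s : incr01 s <->
  StronglySorted Rlt (0 :: s ++ [1]).
Proof.
split.
- intros [H1%Sorted_StronglySorted H2]; [|intros x y z; lra].
  rewrite Forall_forall in H2; constructor.
  + apply SSorted_app; repeat split; auto using SSorted_nil, SSorted_cons.
    intros x y Hx [<-|[]]; apply H2, Hx.
  + apply Forall_app; split; [apply Forall_forall; intros; apply H2; auto|].
    constructor; [lra|auto].
- intros H; inversion H as [|? ? H1 H2]; subst; apply SSorted_app in H1.
  destruct H1 as (H3 & _ & H4); rewrite Forall_forall in H2.
  split; [apply StronglySorted_Sorted, H3|apply Forall_forall].
  intros y Hy; split; [apply H2, in_or_app|apply H4]; simpl; auto.
Qed.

Lemma SSorted_lt_le S : StronglySorted Rlt S -> StronglySorted Rle S.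
Proof.
induction 1 as [|a S H IH Ha]; constructor; auto.
revert Ha; apply Forall_impl; intros; lra.
Qed.

Lemma incr01_sorted01 s : incr01 s -> sorted01 s.
Proof.
intros [H1 H2]; rewrite Forall_forall in H2; split.
- apply SSorted_lt_le, Sorted_StronglySorted; [intros x y z; lra|exact H1].
- intros y Hy; specialize (H2 _ Hy); lra.
Qed.

Lemma in_ends s r : In r (0 :: s ++ [1]) <-> r = 0 \/ In r s \/ r = 1.
Proof. simpl; rewrite in_app_iff; simpl; intuition. Qed.

(** Two lists of positions, each covering the support of [u] in the open interval and completed by 0
    and 1, give the same product. *)
Lemma Rho_WFact u x h : WFact x u -> Rho G u h -> h = x.
Proof.
intros [Ho (s & Hs & Hu & HL)] (s' & Hs' & Hu' & ->).
apply LinFact_iff in HL; destruct HL as (_ & _ & <-).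
change (u 0 :: map u s ++ [u 1]) with (u 0 :: map u s ++ map u [1]).
change (u 0 :: map u s' ++ [u 1]) with (u 0 :: map u s' ++ map u [1]).
rewrite <- !map_app; change (u 0 :: map u ?l) with (map u (0 :: l)).
apply support_values; try apply incr01_ends; auto.
intros r Hr; rewrite !in_ends.
destruct (Rlt_dec 0 r); [destruct (Rlt_dec r 1)|].
- specialize (Hu r (conj r0 r1)); specialize (Hu' r (conj r0 r1)); tauto.
- destruct (Req_dec r 1); [tauto|destruct Hr; apply Ho; lra].
- destruct (Req_dec r 0); [tauto|destruct Hr; apply Ho; lra].
Qed.

(** * Normal forms *)

Definition nontriv (es : list G) : Prop := Forall (fun e => e <> gone) es.

(** Suffix products, from the whole product down to [gone]. For a minimal word the reversed list is
    a maximal chain, see [maxchain_tails]. *)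
Fixpoint tails (es : list G) : list G :=
  gprod es :: match es with nil => nil | _ :: es' => tails es' end.

(* Barycentric weights of the chain [tails es]: the suffix products occurring between two
   consecutive positions are weighted by the distance of these positions. *)
Fixpoint wt (p : R) (ys : list R) (es : list G) (z : G) : R :=
  match ys, es with
  | y :: ys', e :: es' =>
      if excluded_middle_informative (z = gprod es) then y - p else wt y ys' es' z
  | _, _ => if excluded_middle_informative (z = gone) then 1 - p else 0
  end.

Lemma tails_ell es z : additive es -> In z (tails es) ->
  (ell z <= ell (gprod es))%nat /\ (ell z = ell (gprod es) -> z = gprod es).
Proof.
induction es as [|e es IH]; intros H.
- intros [<-|[]]; auto.
- apply additive_cons in H; destruct H as (He & Hes & E); intros [<-|Hz]; auto.
  destruct (IH Hes Hz) as [H1 H2]; simpl; rewrite E; split; [lia|intros E'].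
  assert (ell e = 0)%nat by lia.
  rewrite H2, (ell_eq0 e) by (auto; lia); symmetry; apply gone_l.
Qed.

(** Makes the entries of the chain distinct, so that the tests in [wt] succeed for at most one
    suffix. *)
Lemma tails_tail_lt e es z : additive (e :: es) -> e <> gone -> In z (tails es) ->
  (ell z < ell (e ** gprod es))%nat.
Proof.
intros (He & Hes & E)%additive_cons Hn Hz; rewrite E.
apply tails_ell in Hz; [|auto]; destruct Hz as [Hz _].
assert (ell e <> 0)%nat by (intros E'; apply Hn, ell_eq0; auto); lia.
Qed.

Lemma wt_out p ys es z : length ys = length es -> ~ In z (tails es) -> wt p ys es z = 0.
Proof.
revert p es; induction ys as [|y ys IH]; intros p [|e es] E Hz; try discriminate.
- simpl in *; destruct (excluded_middle_informative (z = gone)) as [->|]; tauto.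
- simpl in Hz |- *.
  destruct (excluded_middle_informative (z = e ** gprod es)) as [->|]; [tauto|].
  apply IH; auto; tauto.
Qed.

Lemma additive_merge a b l : additive (a :: b :: l) ->
  additive (a ** b :: l) /\ ell (a ** b) = (ell a + ell b)%nat.
Proof.
intros (Ha & (Hb & Hl & E1)%additive_cons & E2)%additive_cons; simpl in E2.
rewrite gassoc in E2.
assert (ell (a ** b ** gprod l) <= ell (a ** b) + ell (gprod l))%nat
  by (apply ell_mul; [apply Mon_mul; auto|apply Mon_gprod, Hl]).
assert (ell (a ** b) <= ell a + ell b)%nat by (apply ell_mul; auto).
split; [apply additive_cons; split; [apply Mon_mul; auto|split; [auto|lia]]|lia].
Qed.

(** The lower bound [p] is the preceding position, which [wt] carries along in its recursion. *)
Definition nform (p : R) (ys : list R) (es : list G) : Prop :=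
  length ys = length es /\ StronglySorted Rlt ys /\ (forall y, In y ys -> p <= y <= 1) /\
  additive es /\ nontriv es.

(** Factors at equal positions are merged, from the right end on. Neither [gat] nor [wt] notices: a
    suffix product lost by merging had weight zero. *)
Lemma normal_form ys es p : length ys = length es -> StronglySorted Rle ys ->
  (forall y, In y ys -> p <= y <= 1) -> additive es -> nontriv es ->
  exists ys' es', nform p ys' es' /\ gprod es' = gprod es /\
    gat ys' es' = gat ys es /\ wt p ys' es' = wt p ys es.
Proof.
revert es p; induction ys as [|b ys IH]; intros [|e es] p E HS Hp Ha Hn;
  try discriminate.
{ exists nil, nil; repeat split; auto using SSorted_nil; try apply Ha; contradiction. }
injection E as E; inversion HS as [|? ? HS' Hb]; subst.
assert (Ha' := Ha); apply additive_cons in Ha'; destruct Ha' as (He & Hes & Ee).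
inversion Hn as [|? ? Hn1 Hn2]; subst; rewrite Forall_forall in Hb.
assert (Hpb := Hp b (or_introl eq_refl)).
destruct (IH es b E HS') as (ys' & es' & (E1 & E2 & E3 & E4 & E5) & F1 & F2 & F3); auto.
{ intros y Hy; split; [apply Hb, Hy|apply Hp; right; exact Hy]. }
clear IH.
(* If [b] precedes all positions of the normal form of the rest, it is simply put in front. *)
assert (Hcons : (forall y, In y ys' -> b < y) -> exists ys0 es0, nform p ys0 es0 /\
  gprod es0 = gprod (e :: es) /\ gat ys0 es0 = gat (b :: ys) (e :: es) /\
  wt p ys0 es0 = wt p (b :: ys) (e :: es)).
{ intros Hlt; exists (b :: ys'), (e :: es'); simpl; rewrite F1, F2, F3.
  repeat split; auto; try (simpl; lia).
  - constructor; [auto|apply Forall_forall, Hlt].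
  - destruct H as [<-|H]; [lra|specialize (E3 _ H); lra].
  - destruct H as [<-|H]; [lra|specialize (E3 _ H); lra].
  - constructor; [auto|apply E4].
  - apply (additive_cons e es'); rewrite F1; auto.
  - constructor; auto. }
destruct ys' as [|b' ys'], es' as [|e' es']; try discriminate E1.
{ apply Hcons; intros y []. }
assert (Hbb := E3 b' (or_introl eq_refl)).
inversion E2 as [|? ? E2' Hb']; subst; rewrite Forall_forall in Hb'.
destruct (Req_dec b b') as [<-|Hne].
2:{ apply Hcons; intros y [<-|Hy]; [lra|specialize (Hb' _ Hy); lra]. }
inversion E5 as [|? ? Hn3 Hn4]; subst.
assert (E4' := E4); apply additive_cons in E4'; destruct E4' as (He' & Hes' & Ee').
destruct (additive_merge e e' es') as [M1 M2].
{ apply additive_cons; rewrite F1; auto. }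
(* The two leading positions coincide, so their factors become one; it is nontrivial because the
   lengths add. *)
simpl in F1; exists (b :: ys'), (e ** e' :: es'); repeat split.
- simpl in *; lia.
- constructor; [auto|apply Forall_forall; auto].
- destruct H as [<-|H]; [lra|specialize (Hb' _ H); lra].
- destruct H as [<-|H]; [lra|apply E3; right; exact H].
- apply M1.
- apply M1.
- constructor; [intros H; apply Hn1; rewrite H, ell_one in M2; apply ell_eq0|]; auto; lia.
- simpl; rewrite <- F1; symmetry; apply gassoc.
- apply functional_extensionality; intros r.
  apply (f_equal (fun f => f r)) in F2; simpl in F2 |- *; rewrite <- F2.
  destruct (Req_EM_T b r); [symmetry; apply gassoc|reflexivity].
- apply functional_extensionality; intros z.
  apply (f_equal (fun f => f z)) in F3; simpl in F3 |- *; rewrite <- F3, <- F1, <- !gassoc.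
  destruct (excluded_middle_informative (z = e ** (e' ** gprod es'))); [reflexivity|].
  (* This is the suffix product that leaves the chain; its weight was [b - b]. *)
  destruct (excluded_middle_informative (z = e' ** gprod es')) as [->|]; [|reflexivity].
  rewrite wt_out; [lra|simpl in E1; lia|].
  intros H%(tails_tail_lt e' es'); auto; lia.
Qed.

(** The positions are recovered as the support and the factors as the values on it. *)
Lemma nform_gat_inj p ys1 es1 ys2 es2 : nform p ys1 es1 -> nform p ys2 es2 ->
  gat ys1 es1 = gat ys2 es2 -> ys1 = ys2 /\ es1 = es2.
Proof.
intros (E1 & S1 & _ & _ & N1) (E2 & S2 & _ & _ & N2) E.
assert (K : forall ys es r, StronglySorted Rlt ys -> length ys = length es ->
  nontriv es -> In r ys <-> gat ys es r <> gone).
{ intros ys es r HS El Hn; split.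
  - intros Hr; unfold nontriv in Hn; rewrite Forall_forall in Hn; apply Hn.
    rewrite <- (map_gat ys es HS El) at 2; apply in_map, Hr.
  - intros H; apply NNPP; intros Hr; apply H, gat_out; intros y Hy ->; auto. }
assert (ys1 = ys2).
{ apply SSorted_unique; auto; intros r.
  rewrite (K ys1 es1), (K ys2 es2), E by auto; reflexivity. }
subst ys2; split; auto.
rewrite <- (map_gat ys1 es1), <- (map_gat ys1 es2), E by auto; reflexivity.
Qed.

(** The weight of the whole product gives the first position. Then the next suffix products agree,
    cancellation gives the first factor, and induction does the rest. *)
Lemma nform_wt_inj p ys1 es1 ys2 es2 : nform p ys1 es1 -> nform p ys2 es2 ->
  gprod es1 = gprod es2 -> wt p ys1 es1 = wt p ys2 es2 -> ys1 = ys2 /\ es1 = es2.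
Proof.
revert p es1 ys2 es2; induction ys1 as [|b ys1 IH]; intros p es1 ys2 es2 H1 H2 E W.
- destruct es1 as [|]; [|destruct H1; discriminate].
  destruct es2 as [|e es2], ys2 as [|b ys2]; auto; try (destruct H2; discriminate).
  destruct H2 as (_ & _ & _ & A & N); inversion N as [|? ? N1 _]; subst.
  assert (H := tails_tail_lt e es2 (gprod es2) A N1).
  simpl in E; rewrite <- E, ell_one in H.
  destruct es2; simpl in H; specialize (H (or_introl eq_refl)); lia.
- destruct es1 as [|e1 es1]; [destruct H1; discriminate|].
  destruct es2 as [|e2 es2], ys2 as [|b2 ys2]; auto; try (destruct H2; discriminate).
  { destruct H1 as (_ & _ & _ & A & N); inversion N as [|? ? N1 _]; subst.
    assert (H := tails_tail_lt e1 es1 (gprod es1) A N1).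
    simpl in E; rewrite E, ell_one in H.
    destruct es1; simpl in H; specialize (H (or_introl eq_refl)); lia. }
  destruct H1 as (L1 & S1 & B1 & A1 & N1), H2 as (L2 & S2 & B2 & A2 & N2).
  injection L1 as L1; injection L2 as L2.
  inversion N1 as [|? ? N1a N1b]; inversion N2 as [|? ? N2a N2b]; subst.
  inversion S1 as [|? ? S1a S1b]; inversion S2 as [|? ? S2a S2b]; subst.
  rewrite Forall_forall in S1b, S2b.
  assert (Q1 := proj1 (additive_cons _ _) A1); destruct Q1 as (M1 & A1' & _).
  assert (Q2 := proj1 (additive_cons _ _) A2); destruct Q2 as (M2 & A2' & _).
  simpl in E.
  assert (b = b2).
  { apply (f_equal (fun f => f (e1 ** gprod es1))) in W; simpl in W; rewrite <- E in W.
    destruct (excluded_middle_informative (e1 ** gprod es1 = e1 ** gprod es1)); [lra|].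
    tauto. }
  subst b2.
  (* Neither remaining chain contains the whole product, so both weights vanish there. *)
  assert (W' : wt b ys1 es1 = wt b ys2 es2).
  { apply functional_extensionality; intros z.
    apply (f_equal (fun f => f z)) in W; simpl in W; rewrite <- E in W.
    destruct (excluded_middle_informative (z = e1 ** gprod es1)) as [->|]; [|exact W].
    rewrite !wt_out; auto.
    - rewrite E; intros H%(tails_tail_lt e2 es2); auto; lia.
    - intros H%(tails_tail_lt e1 es1); auto; lia. }
  assert (P : gprod es1 = gprod es2).
  (* The next position, or 1 if there is none, exceeds [b] unless [b = 1]. So the longest element of
     each remaining chain has nonzero weight and lies in the other chain, and by length the two are
     equal. If [b = 1], no positions remain. *)
  { assert (Pos : forall ys es, length ys = length es -> (forall y, In y ys -> b < y <= 1) ->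
      wt b ys es (gprod es) <> 0 \/ b = 1).
    { intros [|y ys] [|e es] L H; try discriminate; simpl.
      - destruct (excluded_middle_informative ((gone : G) = gone)); [|tauto].
        destruct (Req_dec b 1); [auto|left; lra].
      - destruct (excluded_middle_informative (e ** gprod es = e ** gprod es)); [|tauto].
        specialize (H y (or_introl eq_refl)); left; lra. }
    assert (C1 : forall y, In y ys1 -> b < y <= 1)
      by (intros y Hy; split; [auto|apply B1; right; auto]).
    assert (C2 : forall y, In y ys2 -> b < y <= 1)
      by (intros y Hy; split; [auto|apply B2; right; auto]).
    destruct (Pos ys1 es1 L1 C1) as [P1| ->].
    - destruct (Pos ys2 es2 L2 C2) as [P2| ->].
      + rewrite W' in P1; rewrite <- W' in P2.
        assert (I1 : In (gprod es1) (tails es2))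
          by (apply NNPP; intros H; apply P1, wt_out; auto).
        assert (I2 : In (gprod es2) (tails es1))
          by (apply NNPP; intros H; apply P2, wt_out; auto).
        apply tails_ell in I1, I2; auto; apply I1; lia.
      + destruct ys1 as [|y ?]; [|specialize (C1 y (or_introl eq_refl)); lra].
        destruct ys2 as [|y ?]; [|specialize (C2 y (or_introl eq_refl)); lra].
        destruct es1, es2; auto; discriminate.
    - destruct ys1 as [|y ?]; [|specialize (C1 y (or_introl eq_refl)); lra].
      destruct ys2 as [|y ?]; [|specialize (C2 y (or_introl eq_refl)); lra].
      destruct es1, es2; auto; discriminate. }
  destruct (IH b es1 ys2 es2) as [-> ->]; auto.
  + repeat split; auto; try apply A1'; [left; auto|apply B1; right; auto].
  + repeat split; auto; try apply A2'; [left; auto|apply B2; right; auto].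
  + split; auto; f_equal; apply gcancel_r in E; auto.
Qed.

(** Makes the correspondence between factorizations and points of the order complex well defined and
    injective. *)
Lemma gat_wt_iff ys1 es1 ys2 es2 : word es1 -> word es2 -> gprod es1 = gprod es2 ->
  csimplex (length es1) ys1 -> csimplex (length es2) ys2 ->
  gat ys1 es1 = gat ys2 es2 <-> wt 0 ys1 es1 = wt 0 ys2 es2.
Proof.
intros [A1 N1]%word_additive [A2 N2]%word_additive E [L1 [S1 B1]]%csimplex_iff
  [L2 [S2 B2]]%csimplex_iff.
destruct (normal_form ys1 es1 0) as (y1 & e1 & F1 & P1 & <- & <-); auto.
destruct (normal_form ys2 es2 0) as (y2 & e2 & F2 & P2 & <- & <-); auto.
split; intros H.
- destruct (nform_gat_inj 0 y1 e1 y2 e2) as [-> ->]; auto.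
- destruct (nform_wt_inj 0 y1 e1 y2 e2) as [-> ->]; auto; congruence.
Qed.

(** In one direction every value is expanded into a minimal word with its position repeated; in the
    other, the normal form yields the support and the values. *)
Lemma WFact_words x u : WFact x u <-> exists ys es,
  word es /\ gprod es = x /\ csimplex (length es) ys /\ u = gat ys es.
Proof.
split.
- intros [Ho (s & Hs & Hu & (Ha & _ & Hp)%LinFact_iff)].
  destruct (additive_words _ Ha) as (ws & Ew & Hw).
  exists (rep ws (0 :: s ++ [1])), (concat ws); rewrite gprod_concat, Ew.
  assert (E : u 0 :: map u s ++ [u 1] = map u (0 :: s ++ [1]))
    by (simpl; rewrite map_app; reflexivity).
  assert (L : length (0 :: s ++ [1]) = length ws).
  { apply (f_equal (@length G)) in Ew; rewrite length_map in Ew; rewrite Ew, E.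
    rewrite length_map; reflexivity. }
  repeat split; auto; try apply Hw.
  + apply rep_length, L.
  + apply (csimplex_iff (length (concat ws))); split; [apply rep_length, L|].
    apply rep_sorted01, sorted01_ends, incr01_sorted01, Hs.
  + rewrite gat_rep, Ew, E, gat_map; [reflexivity|apply incr01_ends, Hs|].
    intros r Hr; apply in_ends.
    destruct (Rlt_dec r 0); [destruct Hr; auto|].
    destruct (Rlt_dec 1 r); [destruct Hr; auto|].
    destruct (Req_dec r 0); [auto|destruct (Req_dec r 1); [auto|]].
    right; left; apply Hu; auto; lra.
- intros (ys & es & [Ha Hn]%word_additive & <- & [L [HS HB]]%csimplex_iff & ->).
  split; [intros r Hr; apply gat_outside; [split|]; auto|].
  destruct (normal_form ys es 0) as (y' & e' & (L' & S' & B' & A' & N') & P' & <- & _); auto.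
  rewrite <- P'; clear ys es Ha Hn L HS HB P'.
  set (u := gat y' e').
  assert (Eu : map u y' = e') by (apply map_gat; auto).
  assert (Hu : forall r, u r <> gone <-> In r y').
  { intros r; split; intros H.
    - apply NNPP; intros Hr; apply H, gat_out; intros y Hy ->; auto.
    - unfold nontriv in N'; rewrite Forall_forall in N'; apply N'.
      rewrite <- Eu; apply in_map, H. }
  (* Only interior positions are kept; the ends 0 and 1 are listed separately and may carry trivial
     factors. *)
  set (P r := if Rlt_dec 0 r then if Rlt_dec r 1 then true else false else false).
  assert (HP : forall r, P r = true <-> 0 < r < 1).
  { intros r; unfold P; destruct (Rlt_dec 0 r); [destruct (Rlt_dec r 1)|];
      split; intros; try discriminate; auto; lra. }
  assert (Hs : incr01 (filter P y')).
  { split; [apply StronglySorted_Sorted, filter_SSorted, S'|].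
    apply Forall_forall; intros r [_ Hr]%filter_In; apply HP, Hr. }
  exists (filter P y'); split; [exact Hs|split; [intros r Hr01; split|]].
  + intros Hr; apply filter_In; split; [apply Hu, Hr|apply HP; auto].
  + intros [Hr _]%filter_In; apply Hu, Hr.
  + assert (E : u 0 :: map u (filter P y') ++ [u 1] = map u (0 :: filter P y' ++ [1]))
      by (simpl; rewrite map_app; reflexivity).
    destruct (support_values u y' (0 :: filter P y' ++ [1])) as [V1 V2]; auto.
    { apply incr01_ends, Hs. }
    { intros r Hr; rewrite in_ends, filter_In, HP; split; [|intros _; apply Hu, Hr].
      intros Hy; specialize (B' _ Hy).
      destruct (Req_dec r 0); [auto|destruct (Req_dec r 1); [auto|]].
      right; left; split; auto; lra. }
    rewrite Eu in V1, V2.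
    assert (Mu : forall r, Mon (u r)).
    { intros r; destruct (classic (u r = gone)) as [->|Hr%Hu]; [apply Mon_one|].
      destruct A' as [A' _]; rewrite Forall_forall in A'; apply A'.
      rewrite <- Eu; apply in_map, Hr. }
    apply LinFact_iff; rewrite E, <- V1; repeat split.
    * apply Forall_map, Forall_forall; auto.
    * rewrite <- V1, <- V2; apply A'.
    * apply Forall_map, Forall_forall; intros r [Hr _]%filter_In; apply Hu, Hr.
Qed.

Lemma inF_words g u : inF g u <-> exists ys es,
  word es /\ leG (gprod es) g /\ csimplex (length es) ys /\ u = gat ys es.
Proof.
split.
- intros (x & Hx & (ys & es & H1 & <- & H2)%WFact_words); exists ys, es; auto.
- intros (ys & es & H1 & H2 & H3); exists (gprod es); split; auto.
  apply WFact_words; exists ys, es; auto.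
Qed.

(** The weak topology may be tested on simplices of minimal words: such a simplex is itself a cell,
    and every cell maps into one by [rep]. *)
Lemma openF_words g U : openF g U <-> (forall u, U u -> inF g u) /\
  forall es, word es -> leG (gprod es) g ->
    relopen (csimplex (length es)) (fun ys => U (gat ys es)).
Proof.
split; intros [H1 H2]; split; auto.
- intros es Hw Hg; destruct (word_additive es Hw) as [Ha Hn].
  (* The letters of a minimal word form a linear factorization with trivial factors at 0 and 1. *)
  assert (HL : LinFact G X (gprod es) gone es gone).
  { assert (Hm := Mon_gprod es (proj1 Ha)).
    apply LinFact_iff; simpl; rewrite gprod_app; simpl; rewrite gone_l, !gone_r.
    repeat split; auto.
    - constructor; [apply Mon_one|apply Forall_app; split; [apply Ha|]].
      constructor; [apply Mon_one|constructor].
    - simpl; rewrite map_app, gprod_app; simpl.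
      change (fold_right Nat.add 0%nat ?l) with (list_sum l).
      rewrite list_sum_app; simpl; rewrite ell_one, gone_l, !gone_r, (proj2 Ha); lia. }
  apply (relopen_comp _ (csimplex (length es)) _ (fun s => U (chiF G gone es gone s))
    (fun s => s)); auto; [apply (H2 _ _ _ _ Hg HL)|].
  intros p [Lp Hp]%csimplex_iff; rewrite chiF_gat by auto.
  replace (gat (0 :: p ++ [1]) (gone :: es ++ [gone])) with (gat p es); [reflexivity|].
  apply functional_extensionality; intros r; simpl; rewrite gat_app by auto; simpl.
  destruct (Req_EM_T 0 r), (Req_EM_T 1 r); rewrite ?gone_l, ?gone_r; reflexivity.
- intros x xL xs xR Hx (Ha & _ & <-)%LinFact_iff.
  destruct (additive_words _ Ha) as (ws & Ew & Hw).
  assert (Ec : gprod (concat ws) = gprod (xL :: xs ++ [xR]))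
    by (rewrite gprod_concat, Ew; reflexivity).
  apply (relopen_comp _ (csimplex (length (concat ws))) _
    (fun ys => U (gat ys (concat ws))) (fun s => rep ws (0 :: s ++ [1]))).
  + apply H2; [exact Hw|rewrite Ec; exact Hx].
  + intros p [Lp Hp]%csimplex_iff; apply csimplex_iff; split.
    * apply rep_length; apply (f_equal (@length G)) in Ew; rewrite length_map in Ew.
      rewrite Ew; simpl; rewrite !length_app, Lp; reflexivity.
    * apply rep_sorted01, sorted01_ends, Hp.
  + intros p q eps He _ _ Hn; apply near_rep.
    constructor; [rewrite Rminus_diag, Rabs_R0; exact He|].
    apply Forall2_app; [exact Hn|].
    constructor; [rewrite Rminus_diag, Rabs_R0; exact He|constructor].
  + intros p [Lp Hp]%csimplex_iff; rewrite chiF_gat, gat_rep, Ew by auto; reflexivity.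
Qed.

(** * Removing one generator *)

Lemma near_app eps p1 p2 q1 q2 : near eps p1 q1 -> near eps p2 q2 ->
  near eps (p1 ++ p2) (q1 ++ q2).
Proof. apply Forall2_app. Qed.

Lemma near_cons eps r p q : 0 < eps -> near eps p q -> near eps (r :: p) (r :: q).
Proof. intros He; constructor; [rewrite Rminus_diag, Rabs_R0; exact He|auto]. Qed.

Lemma near_tl eps p q : near eps p q -> near eps (tl p) (tl q).
Proof. intros [|]; [constructor|auto]. Qed.

Lemma near_firstn eps n p q : near eps p q -> near eps (firstn n p) (firstn n q).
Proof.
intros H; revert n; induction H; intros [|n]; simpl; constructor; auto; apply IHForall2.
Qed.

Lemma near_skipn eps n p q : near eps p q -> near eps (skipn n p) (skipn n q).
Proof.
intros H; revert n; induction H; intros [|n]; simpl; try constructor; auto;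
  apply IHForall2.
Qed.

Lemma near_nth eps p q m : near eps p q -> (m < length p)%nat ->
  Rabs (nth m p 0 - nth m q 0) < eps.
Proof.
intros H; revert m; induction H; intros [|m] Hm; simpl in *; auto; try lia.
apply IHForall2; lia.
Qed.

(** * Closed pieces of the simplex determined by a position *)

Definition slice {T : Type} (i j : nat) (l : list T) : list T := firstn (j - i) (skipn i l).

Lemma slice_split {T : Type} i j (l : list T) : (i <= j)%nat ->
  firstn i l ++ slice i j l ++ skipn j l = l.
Proof.
intros H; unfold slice.
replace (skipn j l) with (skipn (j - i) (skipn i l))
  by (rewrite skipn_skipn; f_equal; lia).
rewrite !firstn_skipn; reflexivity.
Qed.

(* The pieces [Pat i j r] are closed and cover the simplex of nondecreasing sequences; on each
   of them the maps below are affine. *)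
Definition Pat (i j : nat) (r : R) (q : list R) : Prop :=
  forall m, (m < length q)%nat ->
    ((m < j)%nat -> nth m q 0 <= r) /\ ((i <= m)%nat -> r <= nth m q 0).

Lemma Pat_closed i j r p : ~ Pat i j r p ->
  exists eps, 0 < eps /\ forall q, near eps p q -> ~ Pat i j r q.
Proof.
intros H; apply not_all_ex_not in H; destruct H as [m H].
apply imply_to_and in H; destruct H as [Hm H].
assert (Hne : nth m p 0 <> r) by (intros E; apply H; lra).
(* Some coordinate lies on the wrong side of [r], and within this radius it cannot cross [r]. *)
exists (Rabs (nth m p 0 - r)); split; [apply Rabs_pos_lt; lra|].
intros q Hq Hp; apply H.
assert (Hn := near_nth _ _ _ m Hq Hm).
destruct (Hp m) as [H1 H2]; [rewrite <- (Forall2_length Hq); exact Hm|].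
split; intros Hj; [specialize (H1 Hj)|specialize (H2 Hj)];
  revert Hn; unfold Rabs; destruct (Rcase_abs _), (Rcase_abs _); lra.
Qed.

Lemma Pat_split i j r q : (i <= j <= length q)%nat -> Pat i j r q ->
  (forall y, In y (firstn i q) -> y <= r) /\ (forall y, In y (slice i j q) -> y = r) /\
  (forall y, In y (skipn j q) -> r <= y).
Proof.
intros Hij H; repeat split; intros y (m & Hm & <-)%(In_nth _ _ 0).
- rewrite length_firstn in Hm; rewrite nth_firstn.
  destruct (Nat.ltb_spec m i); [apply H; lia|lia].
- unfold slice in *; rewrite length_firstn, length_skipn in Hm.
  rewrite nth_firstn, nth_skipn; destruct (Nat.ltb_spec m (j - i)); [|lia].
  destruct (H (i + m)%nat) as [H1 H2]; [lia|].
  apply Rle_antisym; [apply H1; lia|apply H2; lia].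
- rewrite length_skipn in Hm; rewrite nth_skipn; apply H; lia.
Qed.

Lemma sorted_split r q : StronglySorted Rle q -> exists y1 y2 y3, q = y1 ++ y2 ++ y3 /\
  (forall y, In y y1 -> y < r) /\ (forall y, In y y2 -> y = r) /\
  (forall y, In y y3 -> r < y).
Proof.
induction 1 as [|y q HS (y1 & y2 & y3 & -> & H1 & H2 & H3) Hy].
- exists nil, nil, nil; repeat split; simpl; tauto.
- rewrite Forall_forall in Hy; destruct (Rtotal_order y r) as [Hr|[->|Hr]].
  + exists (y :: y1), y2, y3; repeat split; auto; intros z [<-|]; auto.
  + exists nil, (r :: y2), y3; repeat split; auto; simpl; try tauto.
    * destruct y1 as [|z y1]; [reflexivity|].
      assert (z < r) by (apply H1; simpl; auto).
      assert (r <= z) by (apply Hy; simpl; auto); lra.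
    * intros z [<-|]; auto.
  + exists nil, nil, (y :: y1 ++ y2 ++ y3); repeat split; simpl; try tauto.
    intros z [<-|Hz]; auto; specialize (Hy _ Hz); lra.
Qed.

(** The numbers of positions below [r] and of positions at most [r] serve as [i] and [j]. On other
    pieces through [q] the block may miss some positions equal to [r], hence the claim about the
    value is made only for this choice. *)
Lemma Pat_exists r q es : sorted01 q -> length q = length es -> exists i j,
  (i <= j <= length q)%nat /\ Pat i j r q /\ gat q es r = gprod (slice i j es).
Proof.
intros [(y1 & y2 & y3 & -> & H1 & H2 & H3)%(sorted_split r) _] E.
exists (length y1), (length y1 + length y2)%nat; rewrite !length_app in *.
split; [lia|split].
- intros m Hm; rewrite !length_app in Hm; split; intros Hj.
  + rewrite app_assoc, app_nth1 by (rewrite length_app; lia).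
    assert (I : In (nth m (y1 ++ y2) 0) (y1 ++ y2)) by (apply nth_In; rewrite length_app; lia).
    apply in_app_or in I; destruct I as [I|I]; [left; auto|right; auto].
  + rewrite app_nth2 by lia.
    assert (I : In (nth (m - length y1) (y2 ++ y3) 0) (y2 ++ y3))
      by (apply nth_In; rewrite length_app; lia).
    apply in_app_or in I; destruct I as [I|I]; [right; symmetry; auto|left; auto].
- rewrite <- (slice_split (length y1) (length y1 + length y2) es) at 1 by lia.
  rewrite !gat_app; unfold slice;
    rewrite ?length_firstn, ?length_skipn; try lia.
  rewrite (gat_out y1), (gat_out y3), gone_l, gone_r.
  + apply gat_const; [exact H2|rewrite length_firstn, length_skipn; lia].
  + intros y Hy; specialize (H3 _ Hy); lra.
  + intros y Hy; specialize (H1 _ Hy); lra.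
Qed.

Lemma uniform_eps (N : nat) (P : nat -> R -> Prop) :
  (forall k d e, P k e -> d <= e -> P k d) ->
  (forall k, (k <= N)%nat -> exists eps, 0 < eps /\ P k eps) ->
  exists eps, 0 < eps /\ forall k, (k <= N)%nat -> P k eps.
Proof.
intros Hm; induction N as [|N IH]; intros H.
- destruct (H 0%nat) as (e & He & HP); [lia|].
  exists e; split; [auto|]; intros [|k] Hk; [auto|lia].
- destruct IH as (e & He & HP); [intros; apply H; lia|].
  destruct (H (S N)) as (e' & He' & HP'); [lia|].
  exists (Rmin e e'); split; [apply Rmin_pos; auto|]; intros k Hk.
  destruct (Nat.eq_dec k (S N)) as [->|].
  + apply (Hm _ _ e'); auto using Rmin_r.
  + apply (Hm _ _ e); [apply HP; lia|apply Rmin_l].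
Qed.

(** There are finitely many pieces: those through [p] supply a radius by hypothesis, the others are
    closed and keep a positive distance from [p]. [ok] selects the pieces on which the map in
    question is defined; points outside them must satisfy [Q] outright. *)
Lemma relopen_pieces n r (Q : list R -> Prop) (ok : nat -> nat -> Prop) :
  (forall q, csimplex n q -> Q q \/
    exists i j, (i <= j <= n)%nat /\ Pat i j r q /\ ok i j) ->
  (forall i j, (i <= j <= n)%nat -> ok i j ->
    relopen (fun q => csimplex n q /\ Pat i j r q) Q) ->
  relopen (csimplex n) Q.
Proof.
intros Hcov Hop p Hp Qp.
destruct (uniform_eps n (fun i e => forall j, (i <= j <= n)%nat -> ok i j ->
  forall q, csimplex n q -> Pat i j r q -> near e p q -> Q q)) as (e & He & H).
{ intros i d e H Hde j Hij Hok q Hq HP Hn; apply (H j); auto.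
  apply (near_weaken d); auto. }
{ intros i Hi.
  destruct (uniform_eps n (fun j e => (i <= j)%nat -> ok i j ->
    forall q, csimplex n q -> Pat i j r q -> near e p q -> Q q)) as (e & He & H).
  - intros j d e H Hde Hij Hok q Hq HP Hn; apply H; auto.
    apply (near_weaken d); auto.
  - intros j Hj; destruct (classic ((i <= j)%nat /\ ok i j)) as [[Hij Hok]|].
    2:{ exists 1; split; [lra|intros; tauto]. }
    destruct (classic (Pat i j r p)) as [HP|HP].
    + destruct (Hop i j (conj Hij Hj) Hok p (conj Hp HP) Qp) as (e & He & H).
      exists e; split; auto.
    + destruct (Pat_closed _ _ _ _ HP) as (e & He & H); exists e; split; auto.
      intros _ _ q _ HPq Hn; destruct (H q Hn HPq).
  - exists e; split; [auto|]; intros; apply (H j); auto; lia. }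
exists e; split; [auto|]; intros q Hq Hn.
destruct (Hcov q Hq) as [|(i & j & Hij & HP & Hok)]; auto.
apply (H i) with (j := j); auto; lia.
Qed.

(* Inverse operations: put the generator [a] in front of the value at [r], respectively delete it
   there; conjugating the earlier values makes the total product change by a left factor [a]. *)
Definition addat (a : G) (r : R) (t : R -> G) (s : R) : G :=
  if Rlt_dec s r then lconj a (t s) else if Req_EM_T s r then a ** t s else t s.

Definition remat (a : G) (r : R) (u : R -> G) (s : R) : G :=
  if Rlt_dec s r then lconj (ginv a) (u s)
  else if Req_EM_T s r then ginv a ** u s else u s.

Lemma rematK a r t : remat a r (addat a r t) = t.
Proof.
apply functional_extensionality; intros s; unfold remat, addat.
destruct (Rlt_dec s r); [apply lconjK|]; destruct (Req_EM_T s r); [|auto]; grp.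
Qed.

Lemma addatK a r u : addat a r (remat a r u) = u.
Proof.
apply functional_extensionality; intros s; unfold remat, addat.
destruct (Rlt_dec s r); [apply lconjVK|]; destruct (Req_EM_T s r); [|auto]; grp.
Qed.

(** Letters of [e1] may sit at [r] as well; there [lconj_swap] turns the conjugated letters followed
    by [a] into [a] followed by the original ones. *)
Lemma addat_gat a r y1 y2 e1 e2 : length y1 = length e1 ->
  (forall y, In y y1 -> y <= r) -> (forall y, In y y2 -> r <= y) ->
  addat a r (gat (y1 ++ y2) (e1 ++ e2)) =
  gat (y1 ++ r :: y2) (map (lconj a) e1 ++ a :: e2).
Proof.
intros E H1 H2; apply functional_extensionality; intros s; unfold addat.
rewrite !gat_app by (rewrite ?length_map; exact E); rewrite gat_lconj; simpl.
destruct (Rlt_dec s r).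
- destruct (Req_EM_T r s); [lra|].
  rewrite (gat_out y2), !gone_r; [auto|]; intros y Hy; specialize (H2 _ Hy); lra.
- destruct (Req_EM_T r s) as [<-|].
  + destruct (Req_EM_T r r) as [_|]; [|lra].
    rewrite !gassoc, lconj_swap; reflexivity.
  + destruct (Req_EM_T s r); [lra|].
    rewrite (gat_out y1), lconj_one; [auto|]; intros y Hy; specialize (H1 _ Hy); lra.
Qed.

Lemma add_word a e1 e2 : word (e1 ++ e2) -> X a ->
  ell (a ** gprod (e1 ++ e2)) = S (ell (gprod (e1 ++ e2))) ->
  gprod (map (lconj a) e1 ++ a :: e2) = a ** gprod (e1 ++ e2) /\
  word (map (lconj a) e1 ++ a :: e2).
Proof.
intros [H E] Ha El.
assert (P : gprod (map (lconj a) e1 ++ a :: e2) = a ** gprod (e1 ++ e2)).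
{ rewrite !gprod_app, gprod_lconj; simpl; rewrite !gassoc, lconj_swap; reflexivity. }
split; [exact P|split].
- apply Forall_app in H; apply Forall_app; split; [|constructor; tauto].
  apply Forall_map; destruct H as [H _]; revert H; apply Forall_impl; intros.
  apply X_lconj; auto.
- rewrite P, El, E, !length_app, length_map; simpl; lia.
Qed.

(** The block [e2] is replaced by a minimal word of its quotient by [a]. The new word is one letter
    shorter and its product loses at most one in length, so it is minimal. *)
Lemma rem_word a e1 e2 e3 : word (e1 ++ e2 ++ e3) -> X a -> leG a (gprod e2) ->
  ell a = 1%nat -> exists e2', length e2 = S (length e2') /\
    gprod e2 = a ** gprod e2' /\ word (map (lconj (ginv a)) e1 ++ e2' ++ e3) /\
    gprod (e1 ++ e2 ++ e3) = a ** gprod (map (lconj (ginv a)) e1 ++ e2' ++ e3).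
Proof.
intros Hw Ha (b & _ & Hb & E & El)%leG_iff Hl.
destruct (word_app _ _ Hw) as [H1 H23]; destruct (word_app _ _ H23) as [H2 H3].
destruct (word_of b Hb) as (e2' & H2' & <-).
assert (L : length e2 = S (length e2')).
{ destruct H2 as [_ <-], H2' as [_ <-]; lia. }
assert (P : gprod (e1 ++ e2 ++ e3) = a ** gprod (map (lconj (ginv a)) e1 ++ e2' ++ e3)).
{ rewrite !gprod_app, gprod_lconj, <- E; unfold lconj; grp. }
exists e2'; split; [auto|split; [auto|split; [|exact P]]].
assert (Hf : Forall X (map (lconj (ginv a)) e1 ++ e2' ++ e3)).
  { apply Forall_app; split; [|apply Forall_app; split; [apply H2'|apply H3]].
    apply Forall_map; destruct H1 as [H1 _]; revert H1; apply Forall_impl; intros.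
    apply X_lconj; auto. }
  split; [exact Hf|]; assert (K := ell_le _ Hf); destruct Hw as [_ Hw]; rewrite P in Hw.
  assert (ell (a ** gprod (map (lconj (ginv a)) e1 ++ e2' ++ e3)) <=
    ell a + ell (gprod (map (lconj (ginv a)) e1 ++ e2' ++ e3)))%nat
    by (apply ell_mul; [apply Mon_X; auto|exists (map (lconj (ginv a)) e1 ++ e2' ++ e3); auto]).
  rewrite !length_app, length_map in *; lia.
Qed.

(** Reinserting [a] undoes the conjugation of [e1], and the blocks [e2] and [a :: e2'] have the same
    product and sit at the same position. *)
Lemma rem_gat a r y1 y2 y3 e1 e2 e2' e3 : length y1 = length e1 ->
  length y2 = length e2 -> length e2 = S (length e2') -> gprod e2 = a ** gprod e2' ->
  (forall y, In y y1 -> y <= r) -> (forall y, In y y2 -> y = r) ->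
  (forall y, In y y3 -> r <= y) ->
  gat (y1 ++ y2 ++ y3) (e1 ++ e2 ++ e3) =
  addat a r (gat (y1 ++ tl y2 ++ y3) (map (lconj (ginv a)) e1 ++ e2' ++ e3)).
Proof.
intros L1 L2 L3 E H1 H2 H3.
destruct y2 as [|y y2]; [simpl in L2; lia|].
assert (y = r) by (apply H2; left; auto); subst y; simpl tl; simpl in L2.
assert (H2' : forall y, In y y2 -> y = r) by (intros; apply H2; right; auto).
rewrite addat_gat; auto; [|rewrite length_map; auto|].
2:{ intros y [Hy|Hy]%in_app_or; [rewrite (H2' _ Hy); lra|auto]. }
rewrite map_map, (map_ext _ (fun x => x)), map_id by (intros; apply lconjVK).
apply functional_extensionality; intros s.
rewrite app_comm_cons, (app_comm_cons e2' e3), !gat_app by (simpl; lia).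
do 2 f_equal; destruct (Req_dec r s) as [<-|n].
- rewrite !gat_const; simpl; auto; lia.
- rewrite !gat_out; auto; intros y Hy; rewrite (H2 _ Hy); exact n.
Qed.

Lemma sorted01_insert r y1 y2 : 0 <= r <= 1 -> sorted01 (y1 ++ y2) ->
  (forall y, In y y1 -> y <= r) -> (forall y, In y y2 -> r <= y) ->
  sorted01 (y1 ++ r :: y2).
Proof.
intros Hr [(S1 & S2 & S3)%SSorted_app B] H1 H2; split.
- apply SSorted_app; split; [auto|split].
  + constructor; [auto|apply Forall_forall, H2].
  + intros x y Hx [<-|Hy]; auto.
- intros y [Hy|[<-|Hy]]%in_app_or; auto; apply B, in_or_app; auto.
Qed.

Lemma sorted01_drop y1 y2 y3 : sorted01 (y1 ++ y2 ++ y3) -> sorted01 (y1 ++ tl y2 ++ y3).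
Proof.
destruct y2 as [|r y2]; [auto|]; simpl.
intros [(S1 & S2 & S3)%SSorted_app B]; inversion S2; subst; split.
- apply SSorted_app; split; [auto|split; [auto|]]; intros x y Hx Hy.
  apply S3; simpl; auto.
- intros y [Hy|Hy]%in_app_or; apply B, in_or_app; simpl; auto.
Qed.

(** Equality in subadditivity for [h ** x ** z], where [x ** z = k], forces equality for
    [h ** x]. *)
Lemma leG_shift h x k : Mon h -> ell (h ** k) = (ell h + ell k)%nat -> leG x k ->
  ell (h ** x) = (ell h + ell x)%nat /\ leG (h ** x) (h ** k).
Proof.
intros Hh E Hx; assert (Hx' := Hx).
apply leG_iff in Hx'; destruct Hx' as (z & Mx & Mz & <- & Ez).
assert (ell (h ** x ** z) <= ell (h ** x) + ell z)%nat
  by (apply ell_mul; auto using Mon_mul).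
assert (ell (h ** x) <= ell h + ell x)%nat by (apply ell_mul; auto).
rewrite gassoc in E; assert (ell (h ** x) = (ell h + ell x)%nat) by lia.
split; [auto|]; apply leG_mul_l_iff; auto using Mon_mul; rewrite gassoc; auto.
Qed.

Lemma gat_Mon ys es s : Forall Mon es -> Mon (gat ys es s).
Proof.
intros H; revert ys; induction H as [|e es He H IH]; intros [|y ys]; simpl;
  auto using Mon_one.
destruct (Req_EM_T y s); auto using Mon_mul.
Qed.

Lemma inF_Mon g u s : inF g u -> Mon (u s).
Proof.
intros (ys & es & [[H _] _]%word_additive & _ & _ & ->)%inF_words.
apply gat_Mon, H.
Qed.

(** The word [es'] depends only on the piece and not on the point [q], so on each piece [addat] is
    the insertion of one coordinate. Minimality of [a :: slice i j es] bounds the value at [r]. *)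
Lemma addat_pattern a r i j es : (i <= j <= length es)%nat -> word es -> X a ->
  0 <= r <= 1 -> ell (a ** gprod es) = S (ell (gprod es)) -> exists es',
    length es' = S (length es) /\ word es' /\ gprod es' = a ** gprod es /\
    word (a :: slice i j es) /\
    forall q, length q = length es -> Pat i j r q ->
      addat a r (gat q es) = gat (firstn i q ++ r :: slice i j q ++ skipn j q) es' /\
      (sorted01 q -> csimplex (length es') (firstn i q ++ r :: slice i j q ++ skipn j q)).
Proof.
intros Hij Hw Ha Hr E.
destruct (add_word a (firstn i es) (slice i j es ++ skipn j es)) as [W1 W2]; auto;
  try (rewrite slice_split; [auto|lia]).
exists (map (lconj a) (firstn i es) ++ a :: slice i j es ++ skipn j es).
rewrite W1, slice_split by lia.
assert (K : length (map (lconj a) (firstn i es) ++ a :: slice i j es ++ skipn j es) =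
  S (length es)).
{ destruct W2 as [_ <-], Hw as [_ <-]; rewrite W1, slice_split by lia; exact E. }
split; [exact K|split; [exact W2|split; [reflexivity|split]]].
{ apply word_app in W2; destruct W2 as [_ W2].
  rewrite app_comm_cons in W2; apply word_app in W2; tauto. }
intros q L HP; assert (HPs := Pat_split i j r q ltac:(lia) HP).
destruct HPs as (P1 & P2 & P3).
assert (P4 : forall y, In y (slice i j q ++ skipn j q) -> r <= y).
{ intros y [Hy|Hy]%in_app_or; [rewrite (P2 _ Hy); lra|auto]. }
split.
- rewrite <- addat_gat; auto; [|rewrite !length_firstn; lia].
  rewrite !slice_split by lia; reflexivity.
- intros Hq; apply csimplex_iff; rewrite K; split.
  + assert (K' := f_equal (@length R) (slice_split i j q (proj1 Hij))).
    rewrite !length_app in *; simpl; rewrite length_app; lia.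
  + apply sorted01_insert; auto; rewrite slice_split by lia; exact Hq.
Qed.

Lemma addat_inF a r g t : X a -> ell a = 1%nat -> 0 <= r <= 1 ->
  ell (a ** g) = (ell a + ell g)%nat -> inF g t ->
  inF (a ** g) (addat a r t) /\ ell (a ** t r) = (ell a + ell (t r))%nat.
Proof.
intros Ha El Hr E (q & es & Hw & Hg & [L Hq]%csimplex_iff & ->)%inF_words.
destruct (leG_shift a (gprod es) g) as [E1 E2]; auto using Mon_X.
destruct (Pat_exists r q es Hq L) as (i & j & Hij & HP & Hv).
destruct (addat_pattern a r i j es) as (es' & _ & W & P & W' & H); auto; try lia.
destruct (H q L HP) as [-> Hs]; split.
- apply inF_words; do 2 eexists; split; [exact W|rewrite P; auto].
- rewrite Hv; assert (H' := W'); apply word_cons in H'; destruct H' as [_ [_ H']].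
  destruct W' as [_ W']; simpl in W'; lia.
Qed.

(** Again one word serves the whole piece. Presenting [gat q es] as a value of [addat] lets [rematK]
    compute [remat] on it. *)
Lemma remat_pattern a r i j es : (i <= j <= length es)%nat -> word es -> X a ->
  ell a = 1%nat -> leG a (gprod (slice i j es)) -> exists es',
    length es = S (length es') /\ word es' /\ gprod es = a ** gprod es' /\
    forall q, length q = length es -> Pat i j r q ->
      gat q es = addat a r (gat (firstn i q ++ tl (slice i j q) ++ skipn j q) es') /\
      (sorted01 q -> csimplex (length es') (firstn i q ++ tl (slice i j q) ++ skipn j q)).
Proof.
intros Hij Hw Ha El Hle; rewrite <- (slice_split i j es) in Hw by lia.
destruct (rem_word a _ _ _ Hw Ha Hle El) as (e2 & L & P & W & E).
assert (K := f_equal (@length G) (slice_split i j es (proj1 Hij))).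
rewrite !length_app in K.
exists (map (lconj (ginv a)) (firstn i es) ++ e2 ++ skipn j es).
rewrite slice_split in E by lia; rewrite !length_app, length_map.
split; [lia|split; [exact W|split; [exact E|]]].
intros q Lq HP; assert (HPs := Pat_split i j r q ltac:(lia) HP).
destruct HPs as (P1 & P2 & P3).
assert (Lq' : length (slice i j q) = length (slice i j es)).
{ unfold slice; rewrite !length_firstn, !length_skipn; lia. }
split.
- rewrite <- (slice_split i j q) at 1 by lia.
  rewrite <- (slice_split i j es) at 1 by lia.
  apply rem_gat; auto; rewrite !length_firstn; lia.
- intros Hq; apply csimplex_iff; split.
  + rewrite !length_app, length_tl, Lq', !length_firstn, !length_skipn; lia.
  + apply sorted01_drop; rewrite slice_split by lia; exact Hq.
Qed.

Lemma remat_inF a r g u : X a -> ell a = 1%nat -> Mon g ->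
  ell (a ** g) = (ell a + ell g)%nat -> inF (a ** g) u -> leG a (u r) ->
  inF g (remat a r u).
Proof.
intros Ha El Mg E (q & es & Hw & Hg & [L Hq]%csimplex_iff & ->)%inF_words Hle.
destruct (Pat_exists r q es Hq L) as (i & j & Hij & HP & Hv).
rewrite Hv in Hle.
destruct (remat_pattern a r i j es) as (es' & L' & W & E' & H); auto; [lia|].
destruct (H q L HP) as [-> Hs].
rewrite rematK; apply inF_words; do 2 eexists; split; [exact W|].
split; [|split; [apply Hs, Hq|reflexivity]].
assert (E1 : ell (gprod es) = S (length es')) by (destruct Hw; lia).
rewrite E' in *; assert (E2 : ell (gprod es') = length es') by apply W.
apply (leG_mul_l_iff a); auto using Mon_X, word_Mon; lia.
Qed.

(** Below [r] conjugation preserves and reflects the order, at [r] the factor [a] cancels because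
    lengths add, and above [r] nothing changes. *)
Lemma addat_order a r g t1 t2 : X a -> ell a = 1%nat -> 0 <= r <= 1 ->
  ell (a ** g) = (ell a + ell g)%nat -> inF g t1 -> inF g t2 ->
  subF G X (addat a r t1) (addat a r t2) <-> subF G X t1 t2.
Proof.
intros Ha El Hr E H1 H2.
assert (K : forall s, leG (addat a r t1 s) (addat a r t2 s) <-> leG (t1 s) (t2 s)).
{ intros s; unfold addat; destruct (Rlt_dec s r); [apply leG_lconj_iff|].
  destruct (Req_EM_T s r) as [->|]; [|reflexivity].
  apply leG_mul_l_iff; eauto using Mon_X, inF_Mon.
  - apply (addat_inF a r g t1); auto.
  - apply (addat_inF a r g t2); auto. }
unfold subF; split; intros H s Hs; apply K; auto.
Qed.

Lemma leG_addat a r g t : X a -> ell a = 1%nat -> 0 <= r <= 1 ->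
  ell (a ** g) = (ell a + ell g)%nat -> inF g t -> leG a (addat a r t r).
Proof.
intros Ha El Hr E Ht; unfold addat.
destruct (Rlt_dec r r); [lra|]; destruct (Req_EM_T r r) as [_|]; [|lra].
apply leG_mul; eauto using Mon_X, inF_Mon; apply (addat_inF a r g t); auto.
Qed.

Lemma near_slice_tl eps i j p q : near eps p q ->
  near eps (firstn i p ++ tl (slice i j p) ++ skipn j p)
    (firstn i q ++ tl (slice i j q) ++ skipn j q).
Proof.
intros H; repeat apply near_app; auto using near_firstn, near_skipn.
apply near_tl, near_firstn, near_skipn, H.
Qed.

Lemma addat_open a r g U : X a -> ell a = 1%nat -> 0 <= r <= 1 ->
  ell (a ** g) = (ell a + ell g)%nat ->
  openF (a ** g) U -> openF g (fun t => inF g t /\ U (addat a r t)).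
Proof.
intros Ha El Hr E [_ HU]%openF_words; apply openF_words; split; [tauto|].
intros es Hw Hg; destruct (leG_shift a (gprod es) g) as [E1 E2]; auto using Mon_X.
apply (relopen_pieces _ r _ (fun i j => True)).
{ intros q [L Hq]%csimplex_iff; right.
  destruct (Pat_exists r q es Hq L) as (i & j & Hij & HP & _).
  exists i, j; split; [lia|auto]. }
intros i j Hij _.
destruct (addat_pattern a r i j es) as (es' & _ & W & P & _ & H); auto; try lia.
apply (relopen_comp _ (csimplex (length es')) _ (fun ys => U (gat ys es'))
  (fun q => firstn i q ++ r :: slice i j q ++ skipn j q)).
- apply HU; [exact W|rewrite P; exact E2].
- intros q [[L Hq]%csimplex_iff HP]; apply H; auto.
- intros p q eps He _ _ Hn; apply near_app, near_cons, near_app;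
    auto using near_firstn, near_skipn; apply near_firstn, near_skipn, Hn.
- intros q [Hc HP]; assert (Hc' := Hc); apply csimplex_iff in Hc'; destruct Hc' as [L Hq].
  rewrite <- (proj1 (H q L HP)); split; [tauto|split; [|auto]].
  apply inF_words; exists q, es; auto.
Qed.

(** The domain of [remat] is closed, so all points outside it are added to the preimage to obtain an
    open set of the whole complex. *)
Lemma remat_open a r g V : X a -> ell a = 1%nat -> 0 <= r <= 1 -> Mon g ->
  ell (a ** g) = (ell a + ell g)%nat -> openF g V ->
  openF (a ** g) (fun u => inF (a ** g) u /\ (leG a (u r) -> V (remat a r u))).
Proof.
intros Ha El Hr Mg E [HV1 HV]%openF_words; apply openF_words; split; [tauto|].
intros es Hw Hg.
assert (Hin : forall q, csimplex (length es) q -> inF (a ** g) (gat q es))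
  by (intros q Hq; apply inF_words; exists q, es; auto).
apply (relopen_pieces _ r _ (fun i j => leG a (gprod (slice i j es)))).
{ intros q Hc; assert (Hc' := Hc); apply csimplex_iff in Hc'; destruct Hc' as [L Hq].
  destruct (Pat_exists r q es Hq L) as (i & j & Hij & HP & Hv).
  destruct (classic (leG a (gprod (slice i j es)))) as [H|H].
  - right; exists i, j; split; [lia|auto].
  - left; split; [auto|]; rewrite Hv; tauto. }
intros i j Hij Hok.
destruct (remat_pattern a r i j es) as (es' & L' & W & P & H); auto.
assert (Hg' : leG (gprod es') g).
{ assert (E1 : ell (gprod es) = S (length es')) by (destruct Hw; lia).
  rewrite P in *; assert (E2 : ell (gprod es') = length es') by apply W.
  apply (leG_mul_l_iff a); auto using Mon_X, word_Mon; lia. }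
apply (relopen_comp _ (csimplex (length es')) _ (fun ys => V (gat ys es'))
  (fun q => firstn i q ++ tl (slice i j q) ++ skipn j q)).
- apply HV; auto.
- intros q [[L Hq]%csimplex_iff HP]; apply H; auto.
- intros p q eps He _ _ Hn; apply near_slice_tl, Hn.
- intros q [Hc HP]; assert (Hc' := Hc); apply csimplex_iff in Hc'; destruct Hc' as [L Hq].
  destruct (H q L HP) as [Eq Hs].
  assert (Ht : inF g (gat (firstn i q ++ tl (slice i j q) ++ skipn j q) es')).
  { apply inF_words; do 2 eexists; split; [exact W|split; [exact Hg'|]]; auto. }
  specialize (Hin q Hc); rewrite Eq, rematK in *.
  assert (Hle := leG_addat a r g _ Ha El Hr E Ht); tauto.
Qed.

Lemma atom_iso a r g : X a -> ell a = 1%nat -> 0 <= r <= 1 -> Mon g ->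
  ell (a ** g) = (ell a + ell g)%nat ->
  topposet_iso (openF (a ** g)) (fun u => inF (a ** g) u /\ leG a (u r)) (subF G X)
    (openF g) (inF g) (subF G X) (remat a r) (addat a r).
Proof.
intros Ha El Hr Mg E.
assert (Hr1 : forall u, inF (a ** g) u /\ leG a (u r) -> inF g (remat a r u))
  by (intros u [H1 H2]; apply remat_inF; auto).
assert (Ha1 : forall t, inF g t -> inF (a ** g) (addat a r t) /\ leG a (addat a r t r)).
{ intros t Ht; split; [apply addat_inF; auto|apply (leG_addat a r g); auto]. }
split; [split; [exact Hr1|split; [exact Ha1|split; [|split; [|split]]]]|].
- intros u _; apply addatK.
- intros t _; apply rematK.
- intros V (W & HW & EW); eexists; split; [apply (remat_open a r g W); auto|].
  intros u Hu; rewrite (EW _ (Hr1 u Hu)); tauto.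
- intros V (W & HW & EW); eexists; split; [apply (addat_open a r g W); auto|].
  intros t Ht; rewrite (EW _ (Ha1 t Ht)); tauto.
- intros u1 u2 H1 H2; rewrite <- (addatK a r u1), <- (addatK a r u2) at 1.
  apply (addat_order a r g); auto.
Qed.

(** * Upper sets and maximal elements *)

Lemma subF_one u : (forall s, Mon (u s)) -> subF G X (fun _ => gone) u.
Proof. intros H s _; apply leG_one, H. Qed.

(** Induction on a minimal word for [v]: [atom_iso] for the first letter is restricted to upper sets
    and composed with the isomorphism for the rest. *)
Lemma up_iso h g v k : WFact h v -> Mon k -> h ** k = g -> ell g = (ell h + ell k)%nat ->
  exists f f', topposet_iso (openF g) (Up G X g v) (subF G X)
    (openF k) (inF k) (subF G X) f f'.
Proof.
intros (ys & es & Hw & <- & [L Hq]%csimplex_iff & ->)%WFact_words Mk <-.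
revert ys L Hq; induction es as [|a es IH]; intros [|r ys] L Hq E; try discriminate.
(* The empty word gives the constant factorization, which lies below every point, so the identity
   works. *)
- simpl gprod in *; rewrite gone_l; exists (fun u => u), (fun u => u).
  assert (K : forall u, Up G X k (gat nil nil) u <-> inF k u).
  { intros u; split; [intros [H _]; exact H|intros H; split; [exact H|]].
    apply (subF_one u); intros s; apply (inF_Mon k), H. }
  split; [|reflexivity].
  apply (homeo_restrict _ _ (inF k) _ (inF k) _); auto; [|intros u Hu; apply K, Hu].
  repeat split; auto; intros V HV; exact HV.
- injection L as L; destruct (word_cons _ _ Hw) as [Ha Hw'].
  assert (El : ell a = 1%nat).
  { change (a :: es) with ([a] ++ es) in Hw; apply word_app in Hw.
    destruct Hw as [[_ Hw] _]; simpl in Hw; rewrite gone_r in Hw; exact Hw. }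
  assert (Hr : 0 <= r <= 1) by (apply Hq; left; auto).
  assert (Hq' : sorted01 ys).
  { destruct Hq as [S B]; inversion S; subst; split; auto; intros; apply B; right; auto. }
  assert (E0 : ell (gprod (a :: es)) = (ell a + ell (gprod es))%nat).
  { destruct Hw as [_ ->], Hw' as [_ ->]; rewrite El; reflexivity. }
  simpl gprod in *; rewrite <- gassoc in *.
  assert (M : Mon (gprod es ** k)) by (apply Mon_mul; auto using word_Mon).
  assert (ell (a ** (gprod es ** k)) <= ell a + ell (gprod es ** k))%nat
    by (apply ell_mul; auto using Mon_X).
  assert (ell (gprod es ** k) <= ell (gprod es) + ell k)%nat
    by (apply ell_mul; auto using word_Mon).
  destruct (IH Hw' ys L Hq') as (f & f' & Hh & Ho); [lia|].
  destruct (atom_iso a r (gprod es ** k)) as [Hh1 Ho1]; auto; [lia|].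
  (* [r] is the least position of [v], so inserting [a] there conjugates no letter. *)
  assert (Ev : gat (r :: ys) (a :: es) = addat a r (gat ys es)).
  { symmetry; apply (addat_gat a r nil ys nil es); auto; [intros y []|].
    destruct Hq as [S _]; inversion S as [|? ? _ S']; apply Forall_forall, S'. }
  rewrite Ev; set (v := gat ys es) in *.
  assert (Hv : inF (gprod es ** k) v).
  { exists (gprod es); split; [apply leG_mul; auto using word_Mon; lia|].
    apply WFact_words; exists ys, es; repeat split; try apply Hw'; auto.
    apply (csimplex_iff (length es)); auto. }
  assert (Hav := proj1 (proj2 Hh1) v Hv).
  assert (K : forall u, inF (a ** (gprod es ** k)) u /\ leG a (u r) ->
    Up G X (a ** (gprod es ** k)) (addat a r v) u <-> Up G X (gprod es ** k) v (remat a r u)).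
  { intros u Hu; specialize (Ho1 (addat a r v) u Hav Hu); rewrite rematK in Ho1.
    assert (Hu' := proj1 Hh1 u Hu); unfold Up; tauto. }
  (* A point above [v] is above [a] at [r], so the upper set lies in the domain of [atom_iso]. *)
  assert (K' : forall u, Up G X (a ** (gprod es ** k)) (addat a r v) u ->
    inF (a ** (gprod es ** k)) u /\ leG a (u r)).
  { intros u [Hu Hs]; split; auto; apply (leG_trans _ (addat a r v r)); [apply Hav|auto]. }
  exists (fun u => f (remat a r u)), (fun t => addat a r (f' t)); split.
  + apply (homeo_comp _ (openF (gprod es ** k)) _ _ (Up G X (gprod es ** k) v) _ _ _ _ _);
      auto.
    apply (homeo_restrict _ _ _ _ _ _ _ _ Hh1); auto; intros u [Hu _]; exact Hu.
  + intros u1 u2 H1 H2; rewrite <- Ho; [|apply K; auto|apply K; auto].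
    apply Ho1; auto.
Qed.

Lemma inF_one u : inF gone u -> u = fun _ => gone.
Proof.
intros (ys & es & [_ Hw] & Hg%leG_ell & _ & ->)%inF_words.
rewrite ell_one in Hg; destruct es; [|simpl in *; lia].
destruct ys; reflexivity.
Qed.

Lemma inF_const k : Mon k -> inF k (fun _ => gone).
Proof.
intros Hk; apply inF_words; exists nil, nil; split; [apply word_nil|].
split; [apply leG_one, Hk|split; [apply csimplex_iff|reflexivity]].
repeat split; try constructor; contradiction.
Qed.

(** All letters of a minimal word are placed at 1. This second point rules out maximality in
    [maximal_iff]. *)
Lemma inF_end k : Mon k -> k <> gone -> exists t, inF k t /\ t <> fun _ => gone.
Proof.
intros Hk Hn; destruct (word_of k Hk) as (es & Hw & <-).
assert (Hrep : forall y, In y (repeat 1 (length es)) -> y = 1)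
  by (intros y; apply repeat_spec).
exists (gat (repeat 1 (length es)) es); split.
- apply inF_words; do 2 eexists; split; [exact Hw|split; [apply leG_refl, Hk|]].
  split; [|reflexivity]; apply csimplex_iff; split; [apply repeat_length|split].
  + clear; induction (length es); simpl; constructor; auto.
    apply Forall_forall; intros y ->%repeat_spec; lra.
  + intros y ->%Hrep; lra.
- intros E; apply (f_equal (fun u => u 1)) in E; apply Hn.
  rewrite gat_const in E; auto using repeat_length.
Qed.

Lemma WFact_Rho x u : WFact x u -> Rho G u x.
Proof.
intros [_ (s & H1 & H2 & H3)]; exists s; split; [exact H1|].
split; [intros r Hr; apply H2, Hr|].
apply LinFact_iff in H3; symmetry; apply H3.
Qed.

Lemma maximal_iff h u : Mon h -> inF h u ->
  (forall w, inF h w -> subF G X u w -> w = u) <-> WFact h u.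
Proof.
intros Hh (x & Hx & Hu).
assert (Hu' : inF h u) by (exists x; auto).
assert (Hup : Up G X h u u)
  by (split; [auto|intros s _; apply leG_refl, (inF_Mon h), Hu']).
apply leG_iff in Hx; destruct Hx as (k & Mx & Mk & E & El).
destruct (up_iso x h u k Hu Mk E) as (f & f' & Hf & _); auto.
destruct Hf as (F1 & F2 & F3 & F4 & _).
split.
- intros Hmax; destruct (classic (k = gone)) as [->|Hk].
  { rewrite gone_r in E; subst; exact Hu. }
  (* The upper set of a maximal [u] is a single point, whereas [inF k] would have two. *)
  destruct (inF_end k Mk Hk) as (t & Ht & Hne); destruct Hne.
  assert (K : forall t, inF k t -> t = f u).
  { intros t' Ht'; destruct (F2 t' Ht') as [H1 H2].
    rewrite <- (F4 t' Ht'), (Hmax _ H1 H2); reflexivity. }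
  rewrite (K _ Ht), (K _ (inF_const k Mk)); reflexivity.
- intros Hu2 w Hw Hs.
  assert (Hr := WFact_Rho _ _ Hu).
  assert (x = h) by (apply (Rho_WFact u); auto); subst x.
  assert (k = gone) by (apply ell_eq0; auto; lia); subst k.
  assert (Hw' : Up G X h u w) by (split; auto).
  assert (Ew := F3 w Hw'); assert (Eu := F3 u Hup).
  rewrite (inF_one (f w)) in Ew by (apply F1; auto).
  rewrite (inF_one (f u)) in Eu by (apply F1; auto); congruence.
Qed.

(** * Maximal chains and the order complex *)

Lemma ltG_trans x y z : ltG G X x y -> ltG G X y z -> ltG G X x z.
Proof.
intros H1 H2; assert (E1 := ltG_ell _ _ H1); assert (E2 := ltG_ell _ _ H2).
split; [apply (leG_trans x y z); [apply H1|apply H2]|intros ->; lia].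
Qed.

Lemma tails_leG es z : word es -> In z (tails es) -> leG z (gprod es).
Proof.
induction es as [|e es IH]; intros Hw; simpl.
- intros [<-|[]]; apply leG_refl, Mon_one.
- destruct (word_cons _ _ Hw) as [He Hes]; intros [<-|Hz]; [apply leG_refl, (word_Mon (e :: es)), Hw|].
  apply (leG_trans _ (gprod es)); [auto|].
  destruct (word_additive _ Hw) as [(H1 & H2 & H3)%additive_cons _].
  apply leG_mul_r; auto using word_Mon.
Qed.

Lemma tails_length es : length (tails es) = S (length es).
Proof. induction es; simpl; auto. Qed.

(** Lengths drop by one along [tails], so an element comparable with all entries is either the top
    or below the next entry. *)
Lemma maxchain_tails es : word es -> maxchain G X (gprod es) (rev (tails es)).
Proof.
intros Hw; split; [|split].
- apply StronglySorted_Sorted; induction es as [|e es IH]; simpl; [repeat constructor|].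
  destruct (word_cons _ _ Hw) as [He Hes].
  destruct (word_additive _ Hw) as [Ha Hn]; inversion Hn; subst.
  apply SSorted_app; split; [auto|split; [repeat constructor|]].
  intros x y Hx%in_rev [<-|[]]; split.
  + apply (tails_leG (e :: es)); [auto|right; exact Hx].
  + intros ->; apply (tails_tail_lt e es) in Hx; auto; lia.
- apply Forall_forall; intros z Hz%in_rev; apply tails_leG; auto.
- intros z Hz Hc.
  assert (Hc' : forall y, In y (tails es) -> leG z y \/ leG y z)
    by (intros y Hy; apply Hc, in_rev; rewrite rev_involutive; exact Hy).
  apply in_rev; rewrite rev_involutive; clear Hc.
  revert Hz Hc'; induction es as [|e es IH]; intros Hz Hc.
  + left; symmetry; apply leG_ell_eq; auto; apply leG_ell in Hz.
    simpl gprod in *; rewrite ell_one in *; lia.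
  + destruct (word_cons _ _ Hw) as [He Hes].
    destruct (Nat.eq_dec (ell z) (ell (gprod (e :: es)))) as [E|E].
    { left; symmetry; apply leG_ell_eq; auto. }
    right; apply IH; auto; [|intros y Hy; apply Hc; right; exact Hy].
    assert (Hle := leG_ell _ _ Hz).
    destruct (Hc (gprod es)) as [|H]; auto; [right; destruct es; left; reflexivity|].
    assert (Hle' := leG_ell _ _ H).
    destruct Hw as [_ Hw], Hes as [Hf Hes]; simpl length in *.
    rewrite <- (leG_ell_eq _ _ H) by lia; apply leG_refl; exists es; auto.
Qed.

(* Maximality forces consecutive elements of the chain to differ by a generator. *)
Lemma maxchain_words h c : Mon h -> maxchain G X h c ->
  exists es, word es /\ gprod es = h /\ c = rev (tails es).
Proof.
remember (ell h) as n eqn:En; revert h c En; induction n as [|n IH];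
  intros h c En Mh (HS & Hle & Hmax).
all: apply Sorted_StronglySorted in HS; [|exact ltG_trans].
all: rewrite Forall_forall in Hle.
(* [h] is comparable with every entry, hence belongs to the chain, and by length it is the last
   one. *)
all: assert (Hh : In h c) by (apply Hmax; [apply leG_refl, Mh|auto]).
all: destruct (exists_last (l := c)) as (c' & x & ->); [intros ->; destruct Hh|].
all: apply SSorted_app in HS; destruct HS as (S1 & _ & S2).
all: assert (x = h) by (apply in_app_or in Hh; destruct Hh as [Hh|[|[]]]; [|auto];
  assert (L1 := ltG_ell _ _ (S2 h x Hh (or_introl eq_refl)));
  assert (L2 := leG_ell _ _ (Hle x (in_elt _ _ _))); lia); subst x.
all: assert (Hlt : forall y, In y c' -> ltG G X y h) by (intros y Hy; apply S2; simpl; auto).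
- destruct c' as [|y c'].
  2:{ assert (L := ltG_ell _ _ (Hlt y (or_introl eq_refl))); lia. }
  exists nil; split; [apply word_nil|].
  rewrite (ell_eq0 h) by auto; split; reflexivity.
- assert (H1 : In gone c').
  { assert (H1 : In gone (c' ++ [h])).
    { apply Hmax; [apply leG_one, Mh|].
      intros y Hy; left; apply leG_one, (leG_Mon_l y h), Hle, Hy. }
    apply in_app_or in H1; destruct H1 as [|[E|[]]]; auto.
    rewrite E, ell_one in En; discriminate. }
  destruct (exists_last (l := c')) as (c'' & x & ->); [intros ->; destruct H1|].
  assert (Hx : ltG G X x h) by (apply Hlt, in_elt).
  assert (Hcx : forall y, In y (c'' ++ [x]) -> leG y x).
  { apply SSorted_app in S1; destruct S1 as (_ & _ & S1).
    intros y [Hy|[<-|[]]]%in_app_or; [apply S1; simpl; auto|].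
    apply leG_refl, (leG_Mon_l x h), Hx. }
  destruct Hx as [Hx Hxn]; assert (Hx' := Hx); apply leG_iff in Hx'.
  destruct Hx' as (d & Mx & Md & E & El).
  destruct (word_of d Md) as (w & Hw & <-).
  destruct w as [|a w].
  { simpl in E; rewrite gone_r in E; tauto. }
  destruct (word_cons _ _ Hw) as [Xa Hw'].
  assert (Ela : (ell (gprod (a :: w)) = ell a + ell (gprod w))%nat).
  { destruct (word_additive _ Hw) as [(_ & _ & H3)%additive_cons _]; exact H3. }
  assert (Ea : ell a = 1%nat).
  { destruct Hw as [_ Hw], Hw' as [_ Hw']; simpl in Hw, Ela; lia. }
  simpl in E, El, Ela; rewrite gassoc in E.
  assert (B1 : (ell (x ** a) <= ell x + ell a)%nat) by (apply ell_mul; auto using Mon_X).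
  assert (B2 : (ell (x ** a ** gprod w) <= ell (x ** a) + ell (gprod w))%nat)
    by (apply ell_mul; auto using Mon_X, Mon_mul, word_Mon).
  rewrite E in B2.
  assert (Hxa : leG x (x ** a)) by (apply leG_mul; auto using Mon_X; lia).
  assert (Hah : leG (x ** a) h).
  { rewrite <- E; apply leG_mul; auto using Mon_mul, Mon_X, word_Mon; rewrite E; lia. }
  (* [x ** a] lies between the last two entries [x] and [h], so by maximality it is an entry; being
     longer than [x], it is [h]. *)
  assert (Eh : x ** a = h).
  { assert (I : In (x ** a) ((c'' ++ [x]) ++ [h])).
    { apply Hmax; auto; intros y [Hy|[<-|[]]]%in_app_or; auto.
      right; apply (leG_trans _ x); auto. }
    apply in_app_or in I; destruct I as [I|[|[]]]; auto.
    apply Hcx, leG_ell in I; lia. }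
  destruct (IH x (c'' ++ [x])) as (es & Wes & Pes & Ees); auto.
  { rewrite <- Eh in En; lia. }
  { split; [apply StronglySorted_Sorted, S1|split; [apply Forall_forall, Hcx|]].
    intros z Hz Hc; assert (I : In z ((c'' ++ [x]) ++ [h])).
    { apply Hmax; [apply (leG_trans _ x); auto|].
      intros y [Hy|[<-|[]]]%in_app_or; [auto|left; apply (leG_trans _ x); auto]. }
    apply in_app_or in I; destruct I as [|[<-|[]]]; auto.
    destruct Hxn; apply leG_antisym; auto. }
  (* The right factor [a] is conjugated to the front, which makes [x] the next suffix product. *)
  assert (P : lconj x a ** gprod es = h) by (rewrite Pes, lconj_swap; exact Eh).
  exists (lconj x a :: es); split; [|split; [exact P|]].
  + split; [constructor; [apply X_lconj, Xa|apply Wes]|].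
    simpl; rewrite P, <- (proj2 Wes), Pes; rewrite <- Eh in El, B2 |- *; lia.
  + simpl; rewrite P, <- Ees; reflexivity.
Qed.

Lemma wt_tails p ys es j : additive es -> nontriv es -> length ys = length es ->
  (j <= length es)%nat -> wt p ys es (nth j (tails es) gone) =
  nth (S j) (p :: ys ++ [1]) 0 - nth j (p :: ys ++ [1]) 0.
Proof.
revert p es j; induction ys as [|y ys IH]; intros p [|e es] j Ha Hn L Hj;
  try discriminate.
- simpl in Hj; destruct j; [|lia]; simpl.
  destruct (excluded_middle_informative ((gone : G) = gone)); [reflexivity|tauto].
- simpl in L, Hj; inversion Hn; subst; destruct j as [|j]; simpl.
  + destruct (excluded_middle_informative (e ** gprod es = e ** gprod es)); [reflexivity|].
    tauto.
  + destruct (excluded_middle_informative (nth j (tails es) gone = e ** gprod es)) as [E|_].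
    * assert (I : In (nth j (tails es) gone) (tails es))
        by (apply nth_In; rewrite tails_length; lia).
      apply (tails_tail_lt e es) in I; auto; rewrite E in I; lia.
    * apply additive_cons in Ha; rewrite IH; auto; try tauto; lia.
Qed.

Lemma ochar_wt ys es t : word es -> length ys = length es ->
  ochar G (rev (tails es)) ys t <-> t = wt 0 ys es.
Proof.
intros [Ha Hn]%word_additive L.
assert (K : ochar G (rev (tails es)) ys (wt 0 ys es)).
{ split; [rewrite length_rev, tails_length; lia|split].
  - intros i; rewrite length_rev, tails_length; intros Hi.
    rewrite rev_nth, tails_length by (rewrite tails_length; lia).
    rewrite wt_tails by (auto; lia).
    (* Reversal turns the index [i] into [length ys - i]; as [i] is at most [length ys], no
       subtraction is truncated. *)
    replace (length ys + 1 - i)%nat with (S (length ys - i)) by lia.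
    replace (S (length es) - S i)%nat with (length ys - i)%nat by lia; reflexivity.
  - intros z Hz; apply wt_out; auto; intros I; apply Hz, in_rev.
    rewrite rev_involutive; exact I. }
split; [|intros ->; exact K].
intros (_ & H1 & H2); destruct K as (_ & K1 & K2).
apply functional_extensionality; intros z.
destruct (classic (In z (rev (tails es)))) as [I|I]; [|rewrite H2, K2; auto].
apply (In_nth _ _ gone) in I; destruct I as (i & Hi & <-).
rewrite H1, K1; auto.
Qed.

Lemma Opt_words h t : Mon h -> Opt G X h t <-> exists ys es,
  word es /\ gprod es = h /\ csimplex (length es) ys /\ t = wt 0 ys es.
Proof.
intros Mh; split.
- intros (c & ys & (es & Hw & <- & ->)%maxchain_words & Hy & Ht); auto.
  rewrite length_rev, tails_length, Nat.sub_1_r in Hy.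
  exists ys, es; split; [auto|split; [auto|split; [exact Hy|]]].
  apply (ochar_wt ys es); auto; apply Hy.
- intros (ys & es & Hw & <- & Hy & ->); exists (rev (tails es)), ys.
  split; [apply maxchain_tails, Hw|].
  rewrite length_rev, tails_length, Nat.sub_1_r; split; [exact Hy|].
  apply (ochar_wt ys es); auto; apply Hy.
Qed.

Lemma relopen_ext (S V V' : list R -> Prop) : (forall p, S p -> V p <-> V' p) ->
  relopen S V -> relopen S V'.
Proof.
intros E H p Sp Vp; destruct (H p Sp) as (eps & He & H'); [apply E; auto|].
exists eps; split; auto; intros q Sq Hn; apply E; auto.
Qed.

Lemma openO_words h U : Mon h -> openO G X h U <-> (forall t, U t -> Opt G X h t) /\
  forall es, word es -> gprod es = h ->
    relopen (csimplex (length es)) (fun ys => U (wt 0 ys es)).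
Proof.
intros Mh.
assert (K : forall es ys, word es -> csimplex (length es) ys ->
  (forall t, ochar G (rev (tails es)) ys t -> U t) <-> U (wt 0 ys es)).
{ intros es ys Hw [L _]; split; [intros H; apply H, ochar_wt; auto|].
  intros H t ->%ochar_wt; auto. }
split; intros [H1 H2]; split; auto.
- intros es Hw <-; assert (H := H2 _ (maxchain_tails es Hw)).
  rewrite length_rev, tails_length, Nat.sub_1_r in H.
  revert H; apply relopen_ext; intros ys Hy; apply K; auto.
- intros c (es & Hw & Hp & ->)%maxchain_words; auto.
  rewrite length_rev, tails_length, Nat.sub_1_r.
  generalize (H2 es Hw Hp); apply relopen_ext; intros ys Hy; symmetry; apply K; auto.
Qed.

(** Both maps are chosen from the relation of having a common word and positions; [gat_wt_iff] makes
    the choice immaterial. On each simplex they become the identity of positions, whence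
    continuity. *)
Lemma WFact_homeo_Opt h : Mon h -> exists f f',
  homeo (openF h) (WFact h) (openO G X h) (Opt G X h) f f'.
Proof.
intros Mh.
set (Q := fun u t => exists ys es, word es /\ gprod es = h /\ csimplex (length es) ys /\
  u = gat ys es /\ t = wt 0 ys es).
set (f := fun u => epsilon (inhabits (fun _ => 0)) (fun t => Q u t)).
set (f' := fun t => epsilon (inhabits (fun _ => gone)) (fun u => Q u t)).
assert (Ef : forall ys es, word es -> gprod es = h -> csimplex (length es) ys ->
  f (gat ys es) = wt 0 ys es).
{ intros ys es H1 H2 H3; unfold f.
  destruct (epsilon_spec (inhabits (fun _ => 0)) (fun t => Q (gat ys es) t))
    as (y' & e' & W1 & W2 & W3 & W4 & W5).
  - exists (wt 0 ys es), ys, es; auto.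
  - rewrite W5; apply gat_wt_iff; auto; congruence. }
assert (Ef' : forall ys es, word es -> gprod es = h -> csimplex (length es) ys ->
  f' (wt 0 ys es) = gat ys es).
{ intros ys es H1 H2 H3; unfold f'.
  destruct (epsilon_spec (inhabits (fun _ => gone)) (fun u => Q u (wt 0 ys es)))
    as (y' & e' & W1 & W2 & W3 & W4 & W5).
  - exists (gat ys es), ys, es; auto.
  - rewrite W4; apply gat_wt_iff; auto; congruence. }
assert (Hf : forall u, WFact h u -> Opt G X h (f u)).
{ intros u (ys & es & H1 & H2 & H3 & ->)%WFact_words; apply Opt_words; auto.
  exists ys, es; auto. }
assert (Hf' : forall t, Opt G X h t -> WFact h (f' t)).
{ intros t (ys & es & H1 & H2 & H3 & ->)%Opt_words; auto; apply WFact_words.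
  exists ys, es; auto. }
exists f, f'; split; [exact Hf|split; [exact Hf'|split; [|split; [|split]]]].
- intros u (ys & es & H1 & H2 & H3 & ->)%WFact_words; rewrite Ef, Ef'; auto.
- intros u (ys & es & H1 & H2 & H3 & ->)%Opt_words; auto; rewrite Ef', Ef; auto.
- intros V (U & [HU1 HU2]%openO_words & E); auto.
  (* The points of [inF h] with product other than [h] are added; they form the other components of
     the disjoint union. *)
  exists (fun u => inF h u /\ (WFact h u -> U (f u))); split.
  + apply openF_words; split; [tauto|]; intros es Hw Hle.
    assert (Hin : forall ys, csimplex (length es) ys -> inF h (gat ys es))
      by (intros ys Hy; apply inF_words; exists ys, es; auto).
    destruct (classic (gprod es = h)) as [Eh|Eh].
    * generalize (HU2 es Hw Eh); apply relopen_ext; intros ys Hy.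
      assert (WFact h (gat ys es)) by (apply WFact_words; exists ys, es; auto).
      specialize (Hin ys Hy); rewrite Ef; tauto.
    (* All points of this simplex have product different from [h], so any radius will do. *)
    * intros p Hp _; exists 1; split; [lra|]; intros q Hq _.
      split; [auto|]; intros HW; destruct Eh.
      apply (Rho_WFact (gat q es)); [exact HW|].
      apply WFact_Rho, WFact_words; exists q, es; auto.
  + intros u Hu; rewrite (E _ (Hf u Hu)); split; [intros H|tauto].
    split; [exists h; split; [apply leG_refl|]|]; auto.
- intros V (U & [HU1 HU2]%openF_words & E).
  exists (fun t => Opt G X h t /\ U (f' t)); split.
  + apply openO_words; auto; split; [tauto|]; intros es Hw Eh.
    generalize (HU2 es Hw); intros H; specialize (H ltac:(rewrite Eh; apply leG_refl, Mh)).
    revert H; apply relopen_ext; intros ys Hy; rewrite Ef' by auto.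
    assert (Opt G X h (wt 0 ys es)) by (apply Opt_words; auto; exists ys, es; auto).
    tauto.
  + intros t Ht; rewrite (E _ (Hf' t Ht)); tauto.
Qed.

End Poset.

(** * Upper sets and their maximal elements in general *)

Theorem theorem5p8 (G : Grp) (X : G -> Prop)
  (HX_conj : conj_closed G X) (HX_gen : generates G X)
  (g : G) (Hg : Mon G X g)
  (v : R -> G) (h h' : G)
  (Hv : inF G X g v) (Hrho : Rho G v h)
  (Hh' : leG G X h' g) (Hhh' : gmul h h' = g) :
  (exists (f : (R -> G) -> (R -> G)) (f' : (R -> G) -> (R -> G)),
     topposet_iso (openF G X g) (Up G X g v) (subF G X)
                  (openF G X h') (inF G X h') (subF G X) f f') /\
  (exists (f : (R -> G) -> (G -> R)) (f' : (G -> R) -> (R -> G)),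
     homeo (openF G X g) (MaxUp G X g v) (openO G X h') (Opt G X h') f f').
Proof.
assert (Mh' : Mon G X h') by (eapply leG_Mon_l; exact Hh').
destruct Hv as (x & Hx & Hvx).
assert (h = x) by (eapply Rho_WFact; eauto); subst x.
(* Comparing [h' ** k = g] with [h ** h' = g] shows that [h] is a conjugate of [k], so it has the
   same length. *)
assert (E : ell G X g = (ell G X h + ell G X h')%nat).
{ apply leG_iff in Hh'; destruct Hh' as (k & _ & Mk & E & El).
  assert (Ek : h = lconj h' k).
  { apply (gcancel_r h'); rewrite lconj_swap, E; exact Hhh'. }
  rewrite Ek, ell_lconj, <- El by auto; lia. }
destruct (up_iso G X HX_conj h g v h' Hvx Mh' Hhh' E) as (f & f' & Hf).
split; [exists f, f'; exact Hf|].
destruct (WFact_homeo_Opt G X HX_conj h' Mh') as (k & k' & Hk).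
exists (fun u => k (f u)), (fun t => f' (k' t)).
(* The order isomorphism carries maximal elements to maximal elements of [inF h'], which by
   [maximal_iff] are the factorizations of [h'] itself. *)
apply (homeo_comp _ (openF G X h') _ _ (WFact G X h') _ _ _ _ _); auto.
destruct Hf as [Hf Ho]; assert (Hf1 := Hf); destruct Hf1 as (F1 & F2 & F3 & F4 & _).
apply (homeo_restrict _ _ _ _ _ _ _ _ Hf).
- intros u [Hu _]; exact Hu.
- intros t Ht; exists h'; split; [apply leG_refl|]; auto.
- intros u Hu; rewrite <- maximal_iff by auto; unfold MaxUp; split.
  + intros [_ H] t Ht Hs;
    assert (Hu' : subF G X u (f' t)) by (apply (Ho u (f' t)); [auto..|rewrite F4; auto]).
    assert (Et : f' t = u) by auto.
    rewrite <- (F4 t Ht), Et; auto.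
  + intros H; split; auto; intros w Hw Hs.
    assert (Hs' : subF G X (f u) (f w)) by (apply (Ho u w); auto).
    assert (Ew : f w = f u) by auto.
    rewrite <- (F3 w Hw), Ew; auto.
Qed.
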